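(* Let $\Bbbk$ be an algebraically closed field of characteristic $0$, let $A$ be the incidence algebra over $\Bbbk$ of $\mathfrak{S}_n$ with respect to the Bruhat order, and for $w\in\mathfrak{S}_n$ let $L_w$ be the simple $A$-module indexed by $w$. Then $L_w$ is perfect if and only if $w$ is the longest element of some parabolic subgroup of $\mathfrak{S}_n$.
   Context: $\mathfrak{S}_n$ is the Coxeter group with simple reflections $\sigma_i=(i,i+1)$; a parabolic subgroup is a subgroup generated by a subset (possibly empty) of the simple reflections. The incidence algebra $A$ is the path algebra of the quiver with vertices $\mathfrak{S}_n$ and an arrow $p\to q$ whenever $p$ covers $q$ in the Bruhat order, modulo the relations that any two paths with the same endpoints coincide. $L_w$ is one-dimensional at $w$, zero elsewhere, with arrows acting by zero. Modules are finite-dimensional left modules. $\mathbf{grade}(M)=\min\{i:\mathrm{Ext}^i_A(M,A)\ne0\}$, and a module $M$ is perfect if $\mathbf{grade}(M)$ equals the projective dimension of $M$. *)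

(* Defs.v *)
From HB Require Import structures.
From mathcomp Require Import all_boot all_order all_algebra all_fingroup.
From Stdlib Require Import ClassicalEpsilon.
Set Implicit Arguments. Unset Strict Implicit. Unset Printing Implicit Defensive.
Import GRing.Theory.
Local Open Scope ring_scope.

Section Coxeter.
Variable n : nat.
Local Notation P := {perm 'I_n}.

(* simple reflection sigma_i = (i, i+1)  (meaningful when i.+1 < n) *)
Definition sref (i : 'I_n) : P :=
  oapp (tperm i) 1%g (insub i.+1 : option 'I_n).

Definition haslen (w : P) (l : nat) : bool :=
  [exists t : l.-tuple 'I_n,
     all (fun i : 'I_n => (i.+1 < n)%N) t &&
     (w == foldr (fun i acc => (sref i * acc)%g) 1%g t)].

(* Coxeter length: minimal number of simple reflections (the existence
   of some word is a fact about S_n; classical choice only selects the branch) *)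
Definition coxlen (w : P) : nat :=
  match excluded_middle_informative (exists l, haslen w l) with
  | left h => ex_minn h
  | right _ => 0
  end.

Definition is_refl (t : P) : bool :=
  [exists i : 'I_n, exists x : P, (i.+1 < n)%N && (t == (x^-1 * sref i * x)%g)].

Definition bruhat_step : rel P :=
  fun u v => [exists t, is_refl t && (v == (u * t)%g)] && (coxlen u < coxlen v)%N.

Definition bruhat (u w : P) : bool := connect bruhat_step u w.

Definition parabolic_longest (w : P) : Prop :=
  exists J : {set 'I_n},
    (forall i, i \in J -> (i.+1 < n)%N) /\
    w \in generated [set sref i | i in J] /\
    (forall v, v \in generated [set sref i | i in J] -> (coxlen v <= coxlen w)%N).

End Coxeter.

(* Finite-dimensional left modules over the incidence algebra A, as   *)
(* representations of the bound quiver (arrows p -> q when p covers q,*)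
(* all paths with same endpoints equal), i.e. a vector space M_p per  *)
(* vertex and a map M_p -> M_q for every q <= p, functorially.        *)
(* Row-vector convention: v |-> v *m rmap p q.                        *)
Section Modules.
Variable k : fieldType.
Variable n : nat.
Local Notation P := {perm 'I_n}.
Local Notation le := (@bruhat n).

Record rep := Rep {
  rdim : P -> nat;
  rmap : forall p q : P, 'M[k]_(rdim p, rdim q) }.

Definition is_rep (M : rep) : Prop :=
  (forall p, rmap M p p = 1%:M) /\
  (forall p q r, le q p -> le r q -> rmap M p r = rmap M p q *m rmap M q r) /\
  (forall p q, ~~ le q p -> rmap M p q = 0).

Definition homT (M N : rep) := forall w : P, 'M[k]_(rdim M w, rdim N w).

Definition is_hom (M N : rep) (f : homT M N) : Prop :=
  forall p q, le q p -> rmap M p q *m f q = f p *m rmap N p q.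

Definition is_surj (M N : rep) (f : homT M N) : Prop :=
  forall w, row_full (f w).

Definition is_zero_mod (M : rep) : Prop := forall w, rdim M w = 0%N.

Definition is_proj (Q : rep) : Prop :=
  is_rep Q /\
  forall (M N : rep) (g : homT M N) (h : homT Q N),
    is_rep M -> is_rep N -> is_hom g -> is_surj g -> is_hom h ->
    exists l : homT Q M, is_hom l /\ forall w, h w = l w *m g w.

Record projres (M : rep) := ProjRes {
  pr_mod : nat -> rep;
  pr_d : forall i, homT (pr_mod i.+1) (pr_mod i);
  pr_eps : homT (pr_mod 0) M }.

Definition is_projres (M : rep) (R : projres M) : Prop :=
  (forall i, is_proj (pr_mod R i)) /\
  (forall i, is_hom (pr_d R i)) /\
  is_hom (pr_eps R) /\ is_surj (pr_eps R) /\
  (forall w, (pr_d R 0 w == kermx (pr_eps R w))%MS) /\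
  (forall i w, (pr_d R i.+1 w == kermx (pr_d R i w))%MS).

Definition ext_nz_res (M N : rep) (R : projres M) (i : nat) : Prop :=
  match i with
  | 0 => exists phi : homT (pr_mod R 0) N,
           is_hom phi /\ (forall w, pr_d R 0 w *m phi w = 0) /\
           exists w, phi w != 0
  | j.+1 => exists phi : homT (pr_mod R j.+1) N,
           is_hom phi /\ (forall w, pr_d R j.+1 w *m phi w = 0) /\
           ~ exists psi : homT (pr_mod R j) N,
               is_hom psi /\ forall w, phi w = pr_d R j w *m psi w
  end.

(* Ext^i_A(M, N) <> 0 (independent of the chosen projective resolution) *)
Definition ext_nz (i : nat) (M N : rep) : Prop :=
  exists R : projres M, is_projres R /\ ext_nz_res N R i.

Definition pdim_le (M : rep) (d : nat) : Prop :=
  exists R : projres M, is_projres R /\ forall i, (d < i)%N -> is_zero_mod (pr_mod R i).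

(* the left regular module A: A_q = e_q A has basis the paths w -> q, q <= w *)
Definition upset (q : P) : {set P} := [set w | le q w].

Definition regmod : rep :=
  @Rep (fun q => #|upset q|)
    (fun p q => \matrix_(i < #|upset p|, j < #|upset q|)
        ((le q p && (enum_val i == enum_val j)))%:R).

Definition simple_mod (w : P) : rep :=
  @Rep (fun q => (q == w) : nat)
    (fun p q => \matrix_(i, j) ((p == q))%:R).

(* grade(M) = min{i : Ext^i(M,A) <> 0};  M perfect iff grade M = pd M *)
Definition perfect (M : rep) : Prop :=
  exists g : nat,
    ext_nz g M regmod /\ (forall j, (j < g)%N -> ~ ext_nz j M regmod) /\
    pdim_le M g /\ (forall d, (d < g)%N -> ~ pdim_le M d).

End Modules.

(* Main.v *)
(** Write Ext(L_w, -) for the functors attached to the simple module L_w and P_v for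
    the projective generated at v. For a simple reflection s, the lifting property
    makes x |-> min(x, xs) and x |-> max(x, xs) monotone. If ws < w, this gives
    Ext^*(L_w, N) = 0 whenever N_x -> N_xs is invertible for all x > xs (pulling
    back along min preserves projective resolutions and kills L_w), and it gives
    Ext^(i+1)(L_w, N) = Ext^i(L_ws, N) whenever N vanishes at all x > xs (from
    0 -> L_ws -> E -> L_w -> 0, with E resolved by projectives generated at such x).
    Hence Ext^i(L_w, P_1) is nonzero exactly for i = l(w) = pd L_w, and L_w is
    perfect iff Ext^i(L_w, P_v) = 0 for all v and all i < l(w).

    If w is longest in W_J, induct on v: a right descent s of v lying in J is also a
    descent of w, and Ext vanishes; otherwise P_v and P_vs agree below w.

    Conversely let J be the set of simple reflections below w. Perfection forces
    Ext^*(L_w, P_x) = 0 for every x <> 1 in W_J, hence Ext^*(L_w, E) = 0 for the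
    two-dimensional modules E supported on {v, vs}, where v > vs in W_J. So if
    Ext^*(L_w, L_v) = 0 then Ext^*(L_w, L_vs) = 0, and finally Ext^*(L_w, L_1) = 0,
    a contradiction. As Ext^*(L_w, L_v) = 0 unless v <= w, every v in W_J is below w. *)
Require Import Defs.
From HB Require Import structures.
From mathcomp Require Import all_boot all_order all_algebra all_fingroup.
From mathcomp Require Import zify.
From Stdlib Require Import ClassicalEpsilon FunctionalExtensionality.

Set Implicit Arguments.
Unset Strict Implicit.
Unset Printing Implicit Defensive.

Import GRing.Theory.

(** * Inversions and the Bruhat order *)

Section Inversions.
Variable n : nat.
Local Notation P := {perm 'I_n}.
Implicit Types (u v w x y z s t : P) (a b i j : 'I_n).
Local Open Scope group_scope.

Definition inversions u : {set 'I_n * 'I_n} :=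
  [set p : 'I_n * 'I_n | (p.1 < p.2)%N && (u p.2 < u p.1)%N].

(** An inversion of [u] is carried by [t] when the moved pair stays increasing and is kept
    otherwise. This injection misses the new inversion [(a, b)]. *)
Lemma inversions_tperm u a b :
  (a < b)%N -> (u a < u b)%N -> (#|inversions u| < #|inversions (tperm a b * u)|)%N.
Proof.
move=> ab uab; set t := tperm a b.
pose f (p : 'I_n * 'I_n) := if (t p.1 < t p.2)%N then (t p.1, t p.2) else p.
have tK c : t (t c) = c by rewrite /t tpermK.
have finj : {in inversions u &, injective f}.
  move=> [c d] [c' d']; rewrite !inE /f /= => /andP[cd _] /andP[cd' _].
  case: ifP => h1; case: ifP => h2 [e1 e2].
  - by rewrite -(tK c) e1 tK -(tK d) e2 tK.
  - by move: h2; rewrite -e1 -e2 !tK cd.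
  - by move: h1; rewrite e1 e2 !tK cd'.
  - by rewrite e1 e2.
rewrite -(card_in_imset finj); apply: proper_card; apply/properP; split.
  apply/subsetP=> _ /imsetP[[c d] + ->]; rewrite !inE /f /= => /andP[cd ucd].
  case: ifP => [-> | ] /=; first by rewrite !permM !tK.
  move: cd ucd; rewrite !permM /t.
  by case: (tpermP a b c); case: (tpermP a b d); intros; subst; rewrite /=; lia.
exists (a, b); first by rewrite inE /= !permM /t tpermL tpermR ab.
apply/imsetP=> -[[c d]]; rewrite inE /f /= => /andP[cd ucd].
case: ifP => h [e1 e2]; last by move: ucd; rewrite -e1 -e2; lia.
by move: cd; rewrite -(tK c) -(tK d) -e1 -e2 /t tpermL tpermR; lia.
Qed.

(** An adjacent transposition preserves the order of every pair of positions except [(a, b)], so it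
    carries all other inversions back to inversions of [u]. *)
Lemma inversions_adjacent u a b :
  b = a.+1 :> nat -> (#|inversions (tperm a b * u)| <= #|inversions u|.+1)%N.
Proof.
move=> ba; set t := tperm a b.
have tK c : t (t c) = c by rewrite /t tpermK.
rewrite (cardsD1 (a, b)) -addn1 addnC leq_add ?leq_b1 //.
pose f (p : 'I_n * 'I_n) := (t p.1, t p.2).
have finj : injective f.
  by move=> [c d] [c' d'] [e1 e2]; rewrite -(tK c) e1 tK -(tK d) e2 tK.
rewrite -(card_imset _ finj); apply/subset_leq_card/subsetP.
move=> _ /imsetP[[c d] + ->]; rewrite !inE /f /= !permM => /and3P[nab cd ->].
rewrite andbT; move: nab cd; rewrite xpair_eqE negb_and -!val_eqE /= /t.
by case: (tpermP a b c); case: (tpermP a b d);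
  move=> *; subst; lia.
Qed.

Lemma inversions1 : inversions 1 = set0.
Proof. by apply/setP=> -[c d]; rewrite !inE /= !perm1; lia. Qed.

Lemma inversionsV u : #|inversions u^-1| = #|inversions u|.
Proof.
suff H v : (#|inversions v^-1| <= #|inversions v|)%N.
  by apply/eqP; rewrite eqn_leq H -{1}(invgK u) H.
pose f (p : 'I_n * 'I_n) := (v^-1 p.2, v^-1 p.1).
have finj : injective f by move=> [c d] [c' d'] [/perm_inj -> /perm_inj ->].
rewrite -(card_imset _ finj); apply/subset_leq_card/subsetP.
by move=> _ /imsetP[[c d] + ->]; rewrite !inE /f /= !permKV andbC.
Qed.

Lemma sref_tperm i : (i.+1 < n)%N -> exists2 j : 'I_n, j = i.+1 :> nat & sref i = tperm i j.
Proof.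
by move=> Hi; exists (Ordinal Hi) => //; rewrite /sref insubT.
Qed.

Lemma invs_le_word (l : seq 'I_n) : all (fun i : 'I_n => (i.+1 < n)%N) l ->
  (#|inversions (foldr (fun i acc => (sref i * acc)%g) 1%g l)| <= size l)%N.
Proof.
elim: l => [|i l IH] /=.
  by rewrite inversions1 cards0.
move=> /andP[Hi /IH {}IH]; have [j ji ->] := sref_tperm Hi.
exact: leq_trans (inversions_adjacent _ ji) _.
Qed.

(** Without a descent [u] is increasing, and counting from the bottom and from the top squeezes
    [u m] to [m]. *)
Lemma exists_left_descent u : u != 1 ->
  exists i j : 'I_n, j = i.+1 :> nat /\ (u j < u i)%N.
Proof.
move=> u1.
case: (boolP [exists i : 'I_n, exists j : 'I_n, (j == i.+1 :> nat) && (u j < u i)%N]).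
  by case/existsP=> i /existsP[j /andP[/eqP ji uij]]; exists i, j.
move=> H; case/eqP: u1.
have asc (i j : 'I_n) : j = i.+1 :> nat -> (u i < u j)%N.
  move=> ji; move: H; rewrite negb_exists => /forallP/(_ i).
  rewrite negb_exists => /forallP/(_ j); rewrite ji eqxx /= -leqNgt leq_eqVlt.
  case/orP=> // /eqP/val_inj/perm_inj e.
  by move: ji; rewrite e; lia.
have le1 (m : nat) (Hm : (m < n)%N) : (m <= u (Ordinal Hm))%N.
  elim: m Hm => // m IH Hm; have Hm' : (m < n)%N by lia.
  by have := asc (Ordinal Hm') (Ordinal Hm) erefl; have := IH Hm'; lia.
have le2 (m : nat) (Hm : (n - m.+1 < n)%N) : (m < n)%N -> (u (Ordinal Hm) <= n - m.+1)%N.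
  elim: m Hm => [|m IH] Hm mn; first by have := ltn_ord (u (Ordinal Hm)); lia.
  have Hm' : (n - m.+1 < n)%N by lia.
  have e : (n - m.+1 = (n - m.+2).+1)%N by lia.
  by have := asc (Ordinal Hm) (Ordinal Hm') e; have := IH Hm'; lia.
apply/permP=> i; rewrite perm1; apply: val_inj => /=.
have h1 := le1 i (ltn_ord i).
have Hm : (n - (n - i.+1).+1 < n)%N by have := ltn_ord i; lia.
have h2 := le2 (n - i.+1)%N Hm (ltac:(have := ltn_ord i; lia)).
have e1 : Ordinal (ltn_ord i) = i by apply: val_inj.
have e2 : Ordinal Hm = i by apply: val_inj => /=; have := ltn_ord i; lia.
by rewrite e1 in h1; rewrite e2 in h2; have := ltn_ord i; lia.
Qed.

Lemma word_of_invs u : haslen u #|inversions u|.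
Proof.
move: {2}#|inversions u| (erefl #|inversions u|) => m.
elim: m u => [|m IH] u Hu.
  have u1 : u = 1.
    apply/eqP; apply: contraT => /exists_left_descent[i [j [ji uij]]].
    move/eqP: Hu; rewrite cards_eq0 => /eqP/setP/(_ (i, j)).
    by rewrite !inE /= uij ji ltnSn.
  by rewrite Hu; apply/existsP; exists [tuple]; rewrite /= u1.
have u1 : u != 1.
  apply: contraPneq Hu => ->.
  by rewrite inversions1 cards0.
have [i [j [ji uij]]] := exists_left_descent u1.
have Hi : (i.+1 < n)%N by rewrite -ji.
have e : sref i = tperm i j by have [j' ji' ->] := sref_tperm Hi; congr tperm; apply: val_inj; rewrite /= ji ji'.
have uE : u = tperm i j * (tperm i j * u) by rewrite mulgA tperm2 mul1g.
have H1 : #|inversions (tperm i j * u)| = m.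
  have := @inversions_tperm (tperm i j * u) i j; rewrite -uE !permM tpermL tpermR ji ltnSn.
  by move/(_ isT uij); have := inversions_adjacent (tperm i j * u) ji; rewrite -uE; lia.
have := IH _ H1; rewrite H1 Hu => /existsP[tw /andP[twa /eqP tw2]].
apply/existsP; exists (cons_tuple i tw); rewrite /= Hi twa /= -tw2 e.
by rewrite -uE.
Qed.

(** Each letter of a word adds at most one inversion, and stripping left descents gives a word with
    exactly as many letters as inversions. *)
Lemma coxlenE u : coxlen u = #|inversions u|.
Proof.
rewrite /coxlen; case: excluded_middle_informative => [h|[]]; last first.
  by exists #|inversions u|; apply: word_of_invs.
case: ex_minnP => m /existsP[tw /andP[twa /eqP ->]] Hm.
apply/eqP; rewrite eqn_leq Hm ?word_of_invs //=.
by rewrite -{2}(size_tuple tw); apply: invs_le_word.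
Qed.

End Inversions.

(** * Lifting along a simple reflection, and parabolic subgroups *)

Section BruhatOrder.
Variable n : nat.
Local Notation P := {perm 'I_n}.
Implicit Types (u v w x y z s t : P) (a b i j : 'I_n) (J : {set 'I_n}).
Local Open Scope group_scope.
Local Notation le := (@bruhat n).
Local Notation len := (@coxlen n).

(** Right multiplication exchanges values, whereas [inversions_tperm] exchanges positions; passing
    to inverses keeps the number of inversions and turns one into the other. *)
Lemma len_tperm u a b : (a < b)%N ->
  (len u < len (u * tperm a b))%N = (u^-1 a < u^-1 b)%N.
Proof.
move=> ab; rewrite !coxlenE -inversionsV -(inversionsV (u * _)) invMg tpermV.
case: (ltnP #|_| #|_|) => H; last first.
  by apply/esym/negbTE; apply: contraL H => /(inversions_tperm ab); rewrite -ltnNge.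
case: (ltngtP (u^-1 a) (u^-1 b)) => // [H'|/val_inj/perm_inj e]; last by move: ab; rewrite e; lia.
have := @inversions_tperm _ (tperm a b * u^-1) a b ab.
by rewrite mulgA tperm2 mul1g !permM tpermL tpermR => /(_ H')/ltn_trans/(_ H); rewrite ltnn.
Qed.

Lemma len1 : len 1 = 0%N.
Proof.
by rewrite coxlenE inversions1 cards0.
Qed.

Definition simple s := exists2 i : 'I_n, (i.+1 < n)%N & s = sref i.

Lemma simple_sref i : (i.+1 < n)%N -> simple (sref i).
Proof. by exists i. Qed.

Lemma mul_sref i : sref i * sref i = 1.
Proof. by rewrite /sref; case: insub => [j|] /=; rewrite ?tperm2 ?mulg1. Qed.

Lemma mulKsimple s u : simple s -> u * s * s = u.
Proof. by case=> i _ ->; rewrite -mulgA mul_sref mulg1. Qed.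

Lemma len_simple s u : simple s ->
  (len (u * s) == (len u).+1) || (len u == (len (u * s)).+1).
Proof.
case=> i Hi ->; have [j ji ->] := sref_tperm Hi.
have ij : (i < j)%N by rewrite ji.
have A x : (len (x * tperm i j) <= (len x).+1)%N.
  rewrite !coxlenE -inversionsV -(inversionsV x) invMg tpermV.
  exact: inversions_adjacent.
have := A u; have := A (u * tperm i j); rewrite -mulgA tperm2 mulg1.
have := len_tperm u ij; have := len_tperm (u * tperm i j) ij.
rewrite -mulgA tperm2 mulg1 invMg tpermV !permM tpermL tpermR.
case: (ltngtP (u^-1 i) (u^-1 j)) => [||/val_inj/perm_inj e]; try lia.
by move: ij; rewrite e; lia.
Qed.

Lemma len_simple1 s : simple s -> len s = 1%N.
Proof. by move=> /(len_simple 1); rewrite mul1g len1; lia. Qed.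

Lemma exists_descent u : u != 1 -> exists2 i : 'I_n, (i.+1 < n)%N & (len (u * sref i) < len u)%N.
Proof.
move=> u1; have [|i [j [ji uij]]] := @exists_left_descent n u^-1; first by rewrite invg_eq1.
have Hi : (i.+1 < n)%N by rewrite -ji.
exists i => //; have := len_simple u (simple_sref Hi).
have [j' ji' ->] := sref_tperm Hi; rewrite (_ : j' = j); last by apply: val_inj; rewrite /= ji ji'.
have := len_tperm u (_ : i < j)%N; rewrite ji ltnSn => /(_ isT); lia.
Qed.

Lemma is_refl_tperm t : is_refl t -> exists a b : 'I_n, (a < b)%N /\ t = tperm a b.
Proof.
case/existsP=> i /existsP[x /andP[Hi /eqP ->]].
have [j ji ->] := sref_tperm Hi.
rewrite -mulgA -[_^-1 * _]/(tperm i j ^ x) tpermJ.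
case: (ltngtP (x i) (x j)) => [H|H|/val_inj/perm_inj e].
- by exists (x i), (x j).
- by exists (x j), (x i); rewrite tpermC.
- by move: ji; rewrite e; lia.
Qed.

Lemma is_refl_simple s : simple s -> is_refl s.
Proof.
case=> i Hi ->; apply/existsP; exists i; apply/existsP; exists 1.
by rewrite Hi invg1 mul1g mulg1 eqxx.
Qed.

Lemma is_reflJ t x : is_refl t -> is_refl (t ^ x).
Proof.
case/existsP=> i /existsP[y /andP[Hi /eqP ->]]; apply/existsP; exists i.
apply/existsP; exists (y * x); rewrite Hi /=; apply/eqP.
by rewrite /conjg invMg !mulgA.
Qed.

Lemma le_refl x : le x x. Proof. exact: connect0. Qed.

Lemma le_trans y x z : le x y -> le y z -> le x z.
Proof. exact: connect_trans. Qed.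

Lemma le_len x y : le x y -> x = y \/ (len x < len y)%N.
Proof.
case/connectP=> p; elim: p x => [|z p IH] x /=; first by move=> _ ->; left.
case/andP=> /andP[_ H1] /IH{}IH /IH[<-|H2]; right; lia.
Qed.

Lemma le_anti x y : le x y -> le y x -> x = y.
Proof. by move=> /le_len[//|H1] /le_len[//|H2]; lia. Qed.

Lemma le_leq_len x y : le x y -> (len x <= len y)%N.
Proof. by case/le_len=> [->|/ltnW]. Qed.

(* The exchange of a Bruhat step through a simple reflection: the inversion
   test for [tperm a b] at [u] and for its conjugate at [u * s] agree unless
   [tperm a b = s]. *)
Lemma bruhat_step_simple s u v : simple s -> bruhat_step u v ->
  v = u * s \/ bruhat_step (u * s) (v * s).
Proof.
move=> ss /andP[/existsP[t /andP[rt /eqP ->]] Huv].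
have [-> | ts] := eqVneq t s; [by left | right].
apply/andP; split.
  apply/existsP; exists (t ^ s); rewrite is_reflJ //=; apply/eqP.
  by rewrite /conjg !mulgA mulgK.
have [a [b [ab tE]]] := is_refl_tperm rt.
move: Huv; rewrite tE len_tperm // => uab.
have -> : u * tperm a b * s = (u * s) * tperm (s a) (s b).
  by rewrite -tpermJ /conjg !mulgA mulgK.
case: ss ts; rewrite {}tE => i Hi ->; have [j ji ->] := sref_tperm Hi => ts.
have sab : (tperm i j a < tperm i j b)%N.
  case: (tpermP i j a) => [ea|ea|/eqP ea1 /eqP ea2];
  case: (tpermP i j b) => [eb|eb|/eqP eb1 /eqP eb2]; subst; rewrite ?eqxx // in ab ts *;
  rewrite -?val_eqE /= in ab * ; do ?[move: ea1 ea2]; do ?[move: eb1 eb2]; rewrite -?val_eqE /=; lia.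
by rewrite len_tperm // invMg tpermV !permM !tpermK.
Qed.

Lemma le1g x : le 1 x.
Proof.
move: {2}(len x) (leqnn (len x)) => m; elim: m x => [|m IH] x Hx.
  by have [->|/exists_descent[i Hi]] := eqVneq x 1; [exact: le_refl | lia].
have [->|/exists_descent[i Hi H]] := eqVneq x 1; first exact: le_refl.
apply: le_trans (IH (x * sref i) _) _; first by lia.
rewrite -{2}(mulKsimple x (simple_sref Hi)); apply: connect1.
rewrite /bruhat_step mulKsimple ?H ?andbT; last exact: simple_sref.
by apply/existsP; exists (sref i); rewrite is_refl_simple ?mulKsimple /=; try exact: simple_sref.
Qed.

Definition cmin s x : P := if (len (x * s) < len x)%N then x * s else x.
Definition cmax s x : P := if (len (x * s) < len x)%N then x else x * s.

Section Cosets.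
Variable s : P.
Hypothesis ss : simple s.

Lemma bruhat_simple x : (len x < len (x * s))%N -> le x (x * s).
Proof.
move=> H; apply: connect1; rewrite /bruhat_step H andbT.
by apply/existsP; exists s; rewrite is_refl_simple /=.
Qed.

Lemma cmin_le x : le (cmin s x) x.
Proof.
rewrite /cmin; case: ifP => H; last exact: le_refl.
by rewrite -{2}(mulKsimple x ss); apply: bruhat_simple; rewrite mulKsimple.
Qed.

Lemma cmax_ge x : le x (cmax s x).
Proof.
rewrite /cmax; case: ifP => H; first exact: le_refl.
by apply: bruhat_simple; have := len_simple x ss; lia.
Qed.

Lemma cmin_mul x : cmin s (x * s) = cmin s x.
Proof.
rewrite /cmin mulKsimple //; have := len_simple x ss.
by case: ifP; case: ifP => //; lia.
Qed.

Lemma cmax_mul x : cmax s (x * s) = cmax s x.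
Proof.
rewrite /cmax mulKsimple //; have := len_simple x ss.
by case: ifP; case: ifP => //; lia.
Qed.

Lemma cmin_cases x : cmin s x = x \/ cmin s x = x * s.
Proof. by rewrite /cmin; case: ifP; [right | left]. Qed.

Lemma cmax_cases x : cmax s x = x \/ cmax s x = x * s.
Proof. by rewrite /cmax; case: ifP; [left | right]. Qed.

Lemma cmin_max x : cmin s (cmax s x) = cmin s x.
Proof. by case: (cmax_cases x) => ->; rewrite ?cmin_mul. Qed.

Lemma cmax_min x : cmax s (cmin s x) = cmax s x.
Proof. by case: (cmin_cases x) => ->; rewrite ?cmax_mul. Qed.

(** The lifting property, by induction along a chain: a step either stays in one coset of [s], or
    can be multiplied by [s] on both ends, which handles the case where the upper end drops. *)
Lemma cmin_mono x y : le x y -> le (cmin s x) (cmin s y).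
Proof.
case/connectP=> p; elim: p x => [|z p IH] x /=; first by move=> _ ->; exact: le_refl.
case/andP=> Hxz /IH{}IH /IH{}IH; apply: le_trans IH.
case: (bruhat_step_simple ss Hxz) => [-> | H]; first by rewrite cmin_mul le_refl.
case: (cmin_cases z) => ->; first exact: le_trans (cmin_le x) (connect1 Hxz).
by rewrite -cmin_mul; exact: le_trans (cmin_le _) (connect1 H).
Qed.

Lemma cmax_mono x y : le x y -> le (cmax s x) (cmax s y).
Proof.
case/connectP=> p; elim: p x => [|z p IH] x /=; first by move=> _ ->; exact: le_refl.
case/andP=> Hxz /IH{}IH /IH{}IH; apply: le_trans IH.
case: (bruhat_step_simple ss Hxz) => [-> | H]; first by rewrite cmax_mul le_refl.
case: (cmax_cases x) => ->; first exact: le_trans (connect1 Hxz) (cmax_ge z).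
by rewrite -cmax_mul; exact: le_trans (connect1 H) (cmax_ge _).
Qed.

Lemma cmin_asc x : (len x < len (x * s))%N -> cmin s x = x.
Proof. by rewrite /cmin => H; case: ifP => //; lia. Qed.

Lemma cmin_desc x : (len (x * s) < len x)%N -> cmin s x = x * s.
Proof. by rewrite /cmin => ->. Qed.

Lemma cmax_desc x : (len (x * s) < len x)%N -> cmax s x = x.
Proof. by rewrite /cmax => ->. Qed.

Lemma len_cmin x : (len (cmin s x) < len (cmin s x * s))%N.
Proof. by rewrite /cmin; have := len_simple x ss; case: ifP; rewrite ?mulKsimple //; lia. Qed.

Lemma len_cmax x : (len (cmax s x * s) < len (cmax s x))%N.
Proof. by rewrite /cmax; have := len_simple x ss; case: ifP; rewrite ?mulKsimple //; lia. Qed.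

Lemma simple_le_desc x : (len (x * s) < len x)%N -> le s x.
Proof.
move=> /cmax_desc <-; have := cmax_mono (le1g x).
by rewrite /cmax mul1g len1 ltn0.
Qed.

End Cosets.

Lemma simple_le s t : simple s -> simple t -> le s t -> s = t.
Proof. by move=> hs ht /le_len[//|]; rewrite !len_simple1. Qed.

(* The standard parabolic subgroup attached to [J], described by the initial
   segments that its elements preserve. *)
Definition stab (J : {set 'I_n}) x :=
  [forall i : 'I_n, ((i \notin J) && (i.+1 < n)%N) ==> [forall a, (x a <= i)%N == (a <= i)%N]].

Lemma stabP J x : reflect (forall i, i \notin J -> (i.+1 < n)%N ->
  forall a, (x a <= i)%N = (a <= i)%N) (stab J x).
Proof.
apply: (iffP forallP) => [H i iJ Hi a | H i].
  by have := H i; rewrite iJ Hi /= => /forallP/(_ a)/eqP.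
by apply/implyP=> /andP[iJ Hi]; apply/forallP=> a; rewrite (H i).
Qed.

Lemma stab1 J : stab J 1.
Proof. by apply/stabP=> i _ _ a; rewrite perm1. Qed.

Lemma stabM J x y : stab J x -> stab J y -> stab J (x * y).
Proof. by move=> /stabP Hx /stabP Hy; apply/stabP=> i iJ Hi a; rewrite permM Hy ?Hx. Qed.

(** A generator exchanges [i] and [i.+1] with [i] in [J], and these lie on the same side of every
    cut after an index outside [J]. *)
Lemma gen_stab J x : (forall i, i \in J -> (i.+1 < n)%N) ->
  x \in generated [set sref i | i in J] -> stab J x.
Proof.
move=> HJ; have Hg : group_set [set y | stab J y].
  by apply/group_setP; split=> [|y z]; rewrite !inE ?stab1 //; exact: stabM.
have /subsetP/(_ x) : <<[set sref i | i in J]>> \subset Group Hg.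
  rewrite gen_subG; apply/subsetP=> _ /imsetP[i iJ ->]; rewrite inE.
  have [j ji ->] := sref_tperm (HJ i iJ).
  apply/stabP=> i' iJ' Hi' a; case: tpermP => [->|->|//]; rewrite ji;
  have : i' != i by [apply: contraNneq iJ' => ->]; rewrite -val_eqE /=; lia.
by move=> H /H; rewrite inE.
Qed.

Lemma stab_desc J x i : stab J x -> (i.+1 < n)%N -> (len (x * sref i) < len x)%N -> i \in J.
Proof.
move=> /stabP Hx Hi Hd; apply: contraT => iJ.
have [j ji e] := sref_tperm Hi; have ij : (i < j)%N by rewrite ji.
have := len_tperm x ij; rewrite -e.
have := Hx i iJ Hi (x^-1 i); have := Hx i iJ Hi (x^-1 j); rewrite !permKV; lia.
Qed.

(** A step up multiplies by [tperm a b] with [a < b] and [x^-1 a < x^-1 b]. Were [a] and [b]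
    separated by a cut that the upper element preserves, the positions [x^-1 a] and [x^-1 b] would
    be in the opposite order. *)
Lemma stab_le J x y : le x y -> stab J y -> stab J x.
Proof.
case/connectP=> p; elim: p x => [|z p IH] x /=; first by move=> _ ->.
case/andP=> /andP[/existsP[t /andP[/is_refl_tperm[a [b [ab ->]]] /eqP ->]]].
rewrite len_tperm // => xab /IH{}IH /IH{}IH /IH /stabP H.
apply/stabP=> i iJ Hi c; have Ha := H i iJ Hi (x^-1 a); have Hb := H i iJ Hi (x^-1 b).
move: Ha Hb (H i iJ Hi c); rewrite !permM !permKV tpermL tpermR.
by case: tpermP => [->|->|_ _]; lia.
Qed.

(** Peel off a right descent: it lies below [w], and so does every simple reflection below the
    shorter element. *)
Lemma gen_simple_le w : w \in generated [set sref i | i in [set i : 'I_n | (i.+1 < n)%N && le (sref i) w]].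
Proof.
move: {2}(len w) (leqnn (len w)) => m; elim: m w => [|m IH] w Hw.
  by have [->|/exists_descent[i Hi]] := eqVneq w 1; [exact: group1 | lia].
have [->|/exists_descent[i Hi H]] := eqVneq w 1; first exact: group1.
have ssi := simple_sref Hi.
rewrite -(mulKsimple w ssi); apply: groupM.
  have : (len (w * sref i) <= m)%N by lia.
  move/IH; apply/subsetP/genS/imsetS/subsetP=> j; rewrite !inE => /andP[-> /le_trans]; apply.
  by have := bruhat_simple ssi (x := w * sref i); rewrite mulKsimple // H; apply.
by rewrite mem_gen // mulKsimple //; apply/imsetP; exists i => //; rewrite inE Hi simple_le_desc.
Qed.

End BruhatOrder.

(** Chain maps and homotopies are built degree by degree with this: the type depends on the degree,
    and the invariant [Q] ensures that each term can be extended. *)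
Lemma dependent_choice_from (T : nat -> Type) (Q : forall i, T i -> Prop)
  (S : forall i, T i -> T i.+1 -> Prop) (x0 : T 0%N) : Q 0%N x0 ->
  (forall i x, Q i x -> exists y, Q i.+1 y /\ S i x y) ->
  exists f : forall i, T i, f 0%N = x0 /\ forall i, Q i (f i) /\ S i (f i) (f i.+1).
Proof.
move=> Q0 QS.
have next i (x : {x | Q i x}) : {y : {y | Q i.+1 y} | S i (sval x) (sval y)}.
  apply: constructive_indefinite_description; case: x => x /= /QS[y [Qy Sy]].
  by exists (exist _ y Qy).
pose F := nat_rect (fun i => {x | Q i x}) (exist _ x0 Q0) (fun i x => sval (next i x)).
exists (fun i => sval (F i)); split=> // i; split; first exact: (svalP (F i)).
exact: (svalP (next i (F i))).
Qed.

(** * Kernels, projective resolutions and the comparison theorem *)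

Section HomologicalAlgebra.
Variables (k : fieldType) (n : nat).
Local Notation P := {perm 'I_n}.
Local Notation le := (@bruhat n).
Local Notation rep := (rep k n).
Local Open Scope ring_scope.

Lemma exact_comp0 m1 m2 m3 (A : 'M[k]_(m1, m2)) (B : 'M[k]_(m2, m3)) :
  (A == kermx B)%MS -> A *m B = 0.
Proof. by case/andP=> H _; apply/eqP; rewrite -sub_kermx. Qed.

Lemma exact_sub m1 m2 m3 m4 (A : 'M[k]_(m1, m2)) (B : 'M[k]_(m2, m3)) (C : 'M[k]_(m4, m2)) :
  (A == kermx B)%MS -> C *m B = 0 -> (C <= A)%MS.
Proof. by case/andP=> _ H /eqP; rewrite -sub_kermx => /submx_trans; apply. Qed.

Lemma exactI m1 m2 m3 (A : 'M[k]_(m1, m2)) (B : 'M[k]_(m2, m3)) :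
  A *m B = 0 -> (forall m (C : 'M[k]_(m, m2)), C *m B = 0 -> (C <= A)%MS) ->
  (A == kermx B)%MS.
Proof. by move=> /eqP H1 H2; rewrite sub_kermx H1 H2 ?mulmx_ker. Qed.

Section Homs.
Variables X Y Z : rep.

Lemma hom_comp (f : homT X Y) (g : homT Y Z) :
  is_hom f -> is_hom g -> is_hom (fun w => f w *m g w).
Proof. by move=> Hf Hg p q pq; rewrite mulmxA Hf // -!mulmxA Hg. Qed.

Lemma hom_add (f g : homT X Y) : is_hom f -> is_hom g -> is_hom (fun w => f w + g w).
Proof. by move=> Hf Hg p q pq; rewrite mulmxDr mulmxDl Hf ?Hg. Qed.

Lemma hom_opp (f : homT X Y) : is_hom f -> is_hom (fun w => - f w).
Proof. by move=> Hf p q pq; rewrite mulmxN mulNmx Hf. Qed.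

Lemma hom_sub (f g : homT X Y) : is_hom f -> is_hom g -> is_hom (fun w => f w - g w).
Proof. by move=> Hf Hg; apply: hom_add => //; exact: hom_opp. Qed.

Lemma hom_zero : is_hom (fun w => 0 : 'M_(rdim X w, rdim Y w)).
Proof. by move=> p q _; rewrite mulmx0 mul0mx. Qed.

Lemma hom_id : is_hom (fun w => 1%:M : 'M_(rdim X w, rdim X w)).
Proof. by move=> p q _; rewrite mulmx1 mul1mx. Qed.

End Homs.

Definition ses (N' N N'' : rep) (iota : homT N' N) (pi : homT N N'') : Prop :=
  [/\ is_rep N', is_rep N & is_rep N''] /\
  [/\ is_hom iota, is_hom pi, forall w, row_free (iota w), is_surj pi
    & forall w, (iota w == kermx (pi w))%MS].

Section Kernels.
Variables (X N' N N'' : rep).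

Lemma factor_mono (iota : homT N' N) (pi : homT N N'') (phi : homT X N) :
  is_hom iota -> (forall w, row_free (iota w)) ->
  (forall w, (iota w == kermx (pi w))%MS) ->
  is_hom phi -> (forall w, phi w *m pi w = 0) ->
  exists phi' : homT X N', is_hom phi' /\ forall w, phi w = phi' w *m iota w.
Proof.
move=> hi fi ei hp p0; exists (fun w => phi w *m pinvmx (iota w)).
have E w : phi w *m pinvmx (iota w) *m iota w = phi w.
  by rewrite mulmxKpV // (exact_sub (ei w)).
split=> // p q pq; apply: (row_free_inj (fi q)).
by rewrite -mulmxA E hp // -[RHS]mulmxA hi // mulmxA E.
Qed.

End Kernels.

(** The kernel in coordinates: [row_base] picks a basis at each vertex, and [pinvmx] expresses the
    restricted maps in it. *)
Definition ker_rep (M N : rep) (g : homT M N) : rep :=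
  @Rep k n (fun w => \rank (kermx (g w)))
    (fun p q => row_base (kermx (g p)) *m rmap M p q *m pinvmx (row_base (kermx (g q)))).

Definition ker_inc (M N : rep) (g : homT M N) : homT (ker_rep g) M :=
  fun w => row_base (kermx (g w)).

Section KernelRep.
Variables (M N : rep) (g : homT M N).
Hypotheses (rM : is_rep M) (rN : is_rep N) (hg : is_hom g).

Lemma ker_inc_free w : row_free (ker_inc g w).
Proof. exact: row_base_free. Qed.

Lemma ker_inc_exact w : (ker_inc g w == kermx (g w))%MS.
Proof. by apply/eqmxP; exact: eq_row_base. Qed.

Lemma ker_inc_hom : is_hom (ker_inc g).
Proof.
move=> p q pq /=; rewrite mulmxKpV //.
apply: (exact_sub (ker_inc_exact q)).
by rewrite -mulmxA hg // mulmxA (exact_comp0 (ker_inc_exact p)) mul0mx.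
Qed.

Lemma ker_rep_rep : is_rep (ker_rep g).
Proof.
case: rM => [r1 [r2 r3]]; split=> [p|]; first by rewrite /= r1 mulmx1 mulmxVp ?row_base_free.
split=> [p q r pq qr | p q /r3 e]; last by rewrite /= e mulmx0 mul0mx.
apply: (row_free_inj (ker_inc_free r)).
have pr : le r p := le_trans qr pq.
rewrite -[RHS]mulmxA !ker_inc_hom //.
by rewrite (r2 p q r) // mulmxA [RHS]mulmxA; congr (_ *m _); rewrite ker_inc_hom.
Qed.

End KernelRep.

(** Projectivity lifts along surjections only, so [d] and [phi] are first corestricted to the kernel
    of [e], onto which [d] is surjective by exactness. *)
Lemma proj_lift (Q A B C : rep) (d : homT A B) (e : homT B C) (phi : homT Q B) :
  is_proj Q -> is_rep A -> is_rep B -> is_rep C -> is_hom d -> is_hom e ->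
  (forall w, (d w == kermx (e w))%MS) ->
  is_hom phi -> (forall w, phi w *m e w = 0) ->
  exists psi : homT Q A, is_hom psi /\ forall w, phi w = psi w *m d w.
Proof.
move=> [_ Qp] rA rB rC hd he ex hp p0.
have hi := ker_inc_hom he; have fi := ker_inc_free e; have ei := ker_inc_exact e.
have [d' [hd' dE]] := factor_mono hi fi ei hd (fun w => exact_comp0 (ex w)).
have [p' [hp' pE]] := factor_mono hi fi ei hp p0.
have sd' : is_surj d'.
  move=> w; rewrite -col_leq_rank -(mxrankMfree _ (fi w)) -dE /=.
  by case/andP: (ex w) => _ /mxrankS; apply.
have [l [hl lE]] := Qp _ _ _ _ rA (ker_rep_rep rB he) hd' sd' hp'.
by exists l; split=> // w; rewrite pE lE -mulmxA -dE.
Qed.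

Lemma proj_lift_surj (Q A B : rep) (d : homT A B) (phi : homT Q B) :
  is_proj Q -> is_rep A -> is_rep B -> is_hom d -> is_surj d -> is_hom phi ->
  exists psi : homT Q A, is_hom psi /\ forall w, phi w = psi w *m d w.
Proof. by move=> [_ Qp] rA rB hd sd hp; exact: Qp sd hp. Qed.

Section Resolutions.
Variables (M : rep) (R : projres M).
Hypothesis rR : is_projres R.

Lemma res_proj i : is_proj (pr_mod R i). Proof. by case: rR. Qed.
Lemma res_rep i : is_rep (pr_mod R i). Proof. by case: (res_proj i). Qed.
Lemma res_hom i : is_hom (@pr_d _ _ _ R i). Proof. by case: rR => _ []. Qed.
Lemma res_eps : is_hom (pr_eps R). Proof. by case: rR => _ [_ []]. Qed.
Lemma res_surj : is_surj (pr_eps R). Proof. by case: rR => _ [_ [_ []]]. Qed.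
Lemma res_ex0 w : (pr_d R 0 w == kermx (pr_eps R w))%MS.
Proof. by case: rR => _ [_ [_ [_ []]]]. Qed.
Lemma res_exS i w : (pr_d R i.+1 w == kermx (pr_d R i w))%MS.
Proof. by case: rR => _ [_ [_ [_ []]]]. Qed.
Lemma res_dd i w : pr_d R i.+1 w *m pr_d R i w = 0.
Proof. exact/exact_comp0/res_exS. Qed.
Lemma res_deps w : pr_d R 0 w *m pr_eps R w = 0.
Proof. exact/exact_comp0/res_ex0. Qed.

(** The augmentation acts as the differential out of degree 0, which makes lifting uniform in the
    degree. *)
Definition killed (X : rep) i : homT X (pr_mod R i) -> Prop :=
  match i with
  | 0 => fun phi => forall w, phi w *m pr_eps R w = 0
  | j.+1 => fun phi => forall w, phi w *m pr_d R j w = 0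
  end.

Lemma killed_lift (X : rep) i (phi : homT X (pr_mod R i)) :
  is_rep M -> is_proj X -> is_hom phi -> killed phi ->
  exists psi : homT X (pr_mod R i.+1), is_hom psi /\ forall w, phi w = psi w *m pr_d R i w.
Proof.
move=> rM pX hp; case: i phi hp => [|i] phi hp H.
  exact: (proj_lift pX (res_rep 1) (res_rep 0) rM (@res_hom 0) res_eps res_ex0 hp H).
exact: (proj_lift pX (res_rep i.+2) (res_rep i.+1) (res_rep i)
   (@res_hom i.+1) (@res_hom i) (@res_exS i) hp H).
Qed.

End Resolutions.

Section ChainMaps.
Variables (M1 M2 : rep) (R1 : projres M1) (R2 : projres M2).
Hypotheses (r1 : is_projres R1) (r2 : is_projres R2) (rM2 : is_rep M2).

Definition chain_map (f : forall i, homT (pr_mod R1 i) (pr_mod R2 i)) : Prop :=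
  (forall i, is_hom (f i)) /\
  forall i w, f i.+1 w *m pr_d R2 i w = pr_d R1 i w *m f i w.

Lemma chain_map_lift (theta : homT M1 M2) : is_hom theta ->
  exists f, chain_map f /\ forall w, f 0%N w *m pr_eps R2 w = pr_eps R1 w *m theta w.
Proof.
move=> ht.
have [f0 [hf0 E0]] := proj_lift_surj (res_proj r1 0) (res_rep r2 0) rM2
  (res_eps r2) (res_surj r2) (hom_comp (res_eps r1) ht).
(* The invariant is what [killed_lift] asks for in order to produce the next component. *)
pose Q i (f : homT (pr_mod R1 i) (pr_mod R2 i)) :=
  is_hom f /\ killed (fun w => pr_d R1 i w *m f w).
pose S i (f : homT (pr_mod R1 i) (pr_mod R2 i)) (g : homT (pr_mod R1 i.+1) (pr_mod R2 i.+1)) :=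
  forall w, g w *m pr_d R2 i w = pr_d R1 i w *m f w.
have Q0 : Q 0%N f0.
  by split=> //= w; rewrite -mulmxA -E0 mulmxA res_deps // mul0mx.
have [] := @dependent_choice_from _ Q S f0 Q0.
  move=> i f [hf kf].
  have [g [hg gE]] := killed_lift r2 rM2 (res_proj r1 i.+1) (hom_comp (res_hom r1 i) hf) kf.
  exists g; split; last by move=> w; rewrite gE.
  by split=> //= w; rewrite -mulmxA -gE mulmxA res_dd // mul0mx.
move=> f [e H]; exists f; split; last by move=> w; rewrite e E0.
by split=> i; [case: (H i) => [[]] | case: (H i)].
Qed.

(** The error left by the homotopy built so far is again killed by the differential, so it lifts to
    the next component. *)
Lemma chain_homotopy f : chain_map f -> (forall w, f 0%N w *m pr_eps R2 w = 0) ->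
  exists h : forall i, homT (pr_mod R1 i) (pr_mod R2 i.+1),
    (forall i, is_hom (h i)) /\
    (forall w, f 0%N w = h 0%N w *m pr_d R2 0 w) /\
    (forall i w, f i.+1 w = pr_d R1 i w *m h i w + h i.+1 w *m pr_d R2 i.+1 w).
Proof.
move=> [hf cf] k0.
have [h0 [hh0 E0]] := killed_lift r2 rM2 (res_proj r1 0) (hf 0%N) k0.
pose T i := homT (pr_mod R1 i) (pr_mod R2 i.+1).
pose Q i (h : T i) := is_hom h /\
  forall w, (f i.+1 w - pr_d R1 i w *m h w) *m pr_d R2 i w = 0.
pose S i (h : T i) (h' : T i.+1) :=
  forall w, f i.+1 w = pr_d R1 i w *m h w + h' w *m pr_d R2 i.+1 w.
have Q0 : Q 0%N h0.
  by split=> // w; rewrite mulmxBl -mulmxA -E0 cf subrr.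
have [] := @dependent_choice_from _ Q S h0 Q0.
  move=> i h [hh kh].
  have [|h' [hh' E]] := killed_lift r2 (i := i.+1) rM2 (res_proj r1 i.+1) _ kh.
    by apply: hom_sub => //; apply: hom_comp => //; exact: res_hom.
  exists h'; split; last by move=> w; rewrite -E addrC subrK.
  split=> // w; rewrite mulmxBl -mulmxA -E cf mulmxBr mulmxA res_dd // mul0mx subr0.
  by rewrite subrr.
move=> h [e H]; exists h; split=> [i|]; first by case: (H i) => [[]].
by split=> [w | i w]; [rewrite e E0 | case: (H i) => _ ->].
Qed.

End ChainMaps.

(** * Cocycles and coboundaries *)

Section Cocycles.
Variables (M : rep) (R : projres M) (N : rep).

Definition cocycle i (phi : homT (pr_mod R i) N) : Prop :=
  is_hom phi /\ forall w, pr_d R i w *m phi w = 0.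

(** In degree 0 only the zero map is a coboundary, so that Ext in degree 0 is Hom. *)
Definition coboundary i : homT (pr_mod R i) N -> Prop :=
  match i with
  | 0 => fun phi => forall w, phi w = 0
  | j.+1 => fun phi => exists psi : homT (pr_mod R j) N,
      is_hom psi /\ forall w, phi w = pr_d R j w *m psi w
  end.

Definition acyclic_at i := forall phi : homT (pr_mod R i) N, cocycle phi -> coboundary phi.

Lemma ext_nz_resE i : ext_nz_res N R i <-> ~ acyclic_at i.
Proof.
case: i => [|i]; split.
- move=> [phi [h [c [w /eqP nz]]]] /(_ phi (conj h c)) /= /(_ w); exact: nz.
- move=> H; apply: NNPP => H2; apply: H => phi [h c] w; apply: NNPP => nz; apply: H2.
  by exists phi; split=> //; split=> //; exists w; exact/eqP.
- by move=> [phi [h [c nz]]] /(_ phi (conj h c)).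
- move=> H; apply: NNPP => H2; apply: H => phi [h c]; apply: NNPP => nz; apply: H2.
  by exists phi.
Qed.

Lemma coboundary_ext i (phi phi' : homT (pr_mod R i) N) : (forall w, phi w = phi' w) ->
  coboundary phi -> coboundary phi'.
Proof.
case: i phi phi' => [|i] phi phi' e /=; first by move=> H w; rewrite -e.
by move=> [psi [h E]]; exists psi; split=> // w; rewrite -e.
Qed.

Lemma coboundary_add i (phi phi' : homT (pr_mod R i) N) :
  coboundary phi -> coboundary phi' -> coboundary (fun w => phi w + phi' w).
Proof.
case: i phi phi' => [|i] phi phi' /=; first by move=> H H' w; rewrite H H' addr0.
move=> [psi [h E]] [psi' [h' E']]; exists (fun w => psi w + psi' w).
by split=> [|w]; [exact: hom_add | rewrite E E' mulmxDr].
Qed.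

Lemma coboundary_zero i : coboundary (fun w => 0 : 'M_(rdim (pr_mod R i) w, rdim N w)).
Proof.
by case: i => [|i] //=; exists (fun w => 0); split=> [|w]; [exact: hom_zero | rewrite mulmx0].
Qed.

Hypothesis rR : is_projres R.

Lemma coboundary_cocycle i (phi : homT (pr_mod R i) N) : coboundary phi -> cocycle phi.
Proof.
case: i phi => [|i] phi /=.
  move=> H; split=> [p q pq | w]; by rewrite !H ?mulmx0 ?mul0mx.
move=> [psi [h E]]; split=> [p q pq | w].
  by rewrite !E (hom_comp (res_hom rR i) h).
by rewrite E mulmxA res_dd // mul0mx.
Qed.

End Cocycles.

Lemma coboundary_comp M (R : projres M) N N' (f : homT N N') i (phi : homT (pr_mod R i) N) :
  is_hom f -> coboundary phi -> coboundary (fun w => phi w *m f w).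
Proof.
move=> hf; case: i phi => [|i] phi /=; first by move=> H w; rewrite H mul0mx.
move=> [psi [h E]]; exists (fun w => psi w *m f w).
by split=> [|w]; [exact: hom_comp | rewrite E mulmxA].
Qed.

Lemma cocycle_comp M (R : projres M) N N' (f : homT N N') i (phi : homT (pr_mod R i) N) :
  is_hom f -> cocycle phi -> cocycle (fun w => phi w *m f w).
Proof.
by move=> hf [h c]; split=> [|w]; [exact: hom_comp | rewrite mulmxA c mul0mx].
Qed.

(** In positive degree the primitive lifts along [f], because its source is projective. *)
Lemma coboundary_lift M (R : projres M) N N' (f : homT N N') i (phi : homT (pr_mod R i) N') :
  is_projres R -> is_rep N -> is_rep N' -> is_hom f -> is_surj f -> coboundary phi ->
  exists phi0 : homT (pr_mod R i) N, coboundary phi0 /\ forall w, phi w = phi0 w *m f w.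
Proof.
move=> rR rN rN' hf sf; case: i phi => [|i] phi /= H.
  by exists (fun w => 0); split=> // w; rewrite H mul0mx.
case: H => psi [h E].
have [psi0 [h0 E0]] := proj_lift_surj (res_proj rR i) rN rN' hf sf h.
exists (fun w => pr_d R i w *m psi0 w); split; last by move=> w; rewrite E E0 mulmxA.
by exists psi0.
Qed.

(** * Vanishing of Ext *)

Lemma acyclic_at_transfer M (R R' : projres M) N i : is_rep M ->
  is_projres R -> is_projres R' -> acyclic_at R' N i -> acyclic_at R N i.
Proof.
move=> rM rR rR' H phi [hp cp].
(* Lifts of the identity in both directions compose to an endomorphism of [R] homotopic to the
   identity, so [phi] and its transport through [R'] differ by a coboundary. *)
have [f [[hf cf] f0]] := chain_map_lift rR' rR rM (hom_id M).
have [g [[hg cg] g0]] := chain_map_lift rR rR' rM (hom_id M).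
have [h [hh [h0 hS]]] : exists h : forall i, homT (pr_mod R i) (pr_mod R i.+1),
    (forall i, is_hom (h i)) /\
    (forall w, g 0%N w *m f 0%N w - 1%:M = h 0%N w *m pr_d R 0 w) /\
    (forall i w, g i.+1 w *m f i.+1 w - 1%:M = pr_d R i w *m h i w + h i.+1 w *m pr_d R i.+1 w).
  apply: (chain_homotopy (f := fun i w => g i w *m f i w - 1%:M) rR rR rM); last first.
    by move=> w; rewrite mulmxBl -mulmxA f0 mulmxA g0 mulmx1 mul1mx mulmx1 subrr.
  split=> [j | j w]; first by apply: hom_sub; [exact: hom_comp | exact: hom_id].
  by rewrite mulmxBl mulmxBr -mulmxA cf !mulmxA cg mul1mx mulmx1.
have : coboundary (fun w => f i w *m phi w).
  apply: H; split=> [|w]; first exact: hom_comp.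
  by rewrite mulmxA -cf -mulmxA cp mulmx0.
clear H; case: i phi hp cp => [|i] phi hp cp /=.
  move=> Hc w; have /(congr1 (fun A => A *m phi w)) := h0 w.
  by rewrite mulmxBl mul1mx -!mulmxA Hc cp !mulmx0 sub0r => /eqP; rewrite oppr_eq0 => /eqP.
move=> [psi [hpsi E]].
exists (fun w => g i w *m psi w - h i w *m phi w); split.
  by apply: hom_sub; apply: hom_comp.
move=> w; have := hS i w => /(congr1 (fun A => A *m phi w)).
rewrite mulmxBl mulmxDl mul1mx -!mulmxA cp mulmx0 addr0 E => e.
rewrite mulmxBr -e !mulmxA cg.
by rewrite opprB addrC subrK.
Qed.

Definition ext_zero M N i : Prop := forall R : projres M, is_projres R -> acyclic_at R N i.

Lemma ext_zeroI M (R : projres M) N i : is_rep M -> is_projres R -> acyclic_at R N i ->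
  ext_zero M N i.
Proof. by move=> rM rR H R' rR'; exact: acyclic_at_transfer H. Qed.

(** The identity of the resolution covers a zero map, so [chain_homotopy] contracts the
    resolution. *)
Lemma ext_zero_zero M N i : is_rep M -> is_zero_mod M -> ext_zero M N i.
Proof.
move=> rM zM R rR phi [hp cp].
have [h [hh [h0 hS]]] : exists h : forall i, homT (pr_mod R i) (pr_mod R i.+1),
    (forall i, is_hom (h i)) /\
    (forall w, 1%:M = h 0%N w *m pr_d R 0 w) /\
    (forall i w, 1%:M = pr_d R i w *m h i w + h i.+1 w *m pr_d R i.+1 w).
  apply: (chain_homotopy (f := fun i w => 1%:M) rR rR rM).
    by split=> [j|j w]; [exact: hom_id | rewrite mulmx1 mul1mx].
  by move=> w; rewrite mul1mx; move: (pr_eps R w); rewrite zM => A; exact: thinmx0.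
case: i phi hp cp => [|i] phi hp cp /=.
  by move=> w; rewrite -[phi w]mul1mx h0 -mulmxA cp mulmx0.
exists (fun w => h i w *m phi w); split=> [|w]; first exact: hom_comp.
by rewrite -[LHS]mul1mx hS mulmxDl -!mulmxA cp mulmx0 addr0.
Qed.

(** * Long exact sequence in the second variable *)

Section LongExact.
Variables (M N' N N'' : rep) (iota : homT N' N) (pi : homT N N'').
Hypothesis H : ses iota pi.

(** Subtract a coboundary with the same image in [N'']; the difference is a cocycle with values in
    [N']. *)
Lemma ext_zero_mid i : ext_zero M N' i -> ext_zero M N'' i -> ext_zero M N i.
Proof.
move=> V' V'' R rR phi cp; case: H => [[r' r r''] [hi hp fi sp ei]].
have [phi0 [c0 E0]] := coboundary_lift rR r r'' hp sp (V'' R rR _ (cocycle_comp hp cp)).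
have [h0 z0] := coboundary_cocycle rR c0; case: cp => [hphi zphi].
have [|phi' [h' E']] := factor_mono hi fi ei (hom_sub hphi h0).
  by move=> w; rewrite mulmxBl E0 subrr.
have c' : cocycle phi'.
  split=> // w; apply: (row_free_inj (fi w)).
  by rewrite -mulmxA -E' mulmxBr zphi z0 subrr mul0mx.
apply: coboundary_ext (coboundary_add (coboundary_comp hi (V' R rR _ c')) c0) => w.
by rewrite -E' subrK.
Qed.

(** Lift the cocycle to a cochain in [N]. Its differential is a cocycle in [N'], and a primitive of
    that corrects the lift to a cocycle. *)
Lemma ext_zero_quot i : ext_zero M N i -> ext_zero M N' i.+1 -> ext_zero M N'' i.
Proof.
move=> V V' R rR phi [hphi zphi]; case: H => [[r' r r''] [hi hp fi sp ei]].
have [psi [hpsi Epsi]] := proj_lift_surj (res_proj rR i) r r'' hp sp hphi.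
have [|chi [hchi Echi]] := factor_mono hi fi ei (hom_comp (res_hom rR i) hpsi).
  by move=> w; rewrite -mulmxA -Epsi.
have cchi : cocycle chi.
  split=> // w; apply: (row_free_inj (fi w)).
  by rewrite -mulmxA -Echi mulmxA res_dd // !mul0mx.
have [xi [hxi Exi]] := V' R rR _ cchi.
have cz : cocycle (fun w => psi w - xi w *m iota w).
  split=> [|w]; first by apply: hom_sub => //; exact: hom_comp.
  by rewrite mulmxBr Echi Exi mulmxA subrr.
apply: coboundary_ext (coboundary_comp hp (V R rR _ cz)) => w.
by rewrite mulmxBl -Epsi -mulmxA (exact_comp0 (ei w)) mulmx0 subr0.
Qed.

(** A primitive in [N] becomes a cocycle in [N''], hence a coboundary; subtracting a lift of it
    moves the primitive into [N']. *)
Lemma ext_zero_sub i : ext_zero M N'' i -> ext_zero M N i.+1 -> ext_zero M N' i.+1.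
Proof.
move=> V'' V R rR phi cphi; case: H => [[r' r r''] [hi hp fi sp ei]].
have [psi [hpsi Epsi]] := V R rR _ (cocycle_comp hi cphi).
have cz : cocycle (fun w => psi w *m pi w).
  split=> [|w]; first exact: hom_comp.
  by rewrite mulmxA -Epsi -mulmxA (exact_comp0 (ei w)) mulmx0.
have [psi0 [c0 E0]] := coboundary_lift rR r r'' hp sp (V'' R rR _ cz).
have [h0 z0] := coboundary_cocycle rR c0.
have [|xi [hxi Exi]] := factor_mono hi fi ei (hom_sub hpsi h0).
  by move=> w; rewrite mulmxBl E0 subrr.
exists xi; split=> // w; apply: (row_free_inj (fi w)).
by rewrite -mulmxA -Exi mulmxBr z0 subr0 Epsi.
Qed.

Lemma ext_zero_sub0 : ext_zero M N 0 -> ext_zero M N' 0.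
Proof.
move=> V R rR phi cphi w; case: H => [_ [hi hp fi sp ei]].
by apply: (row_free_inj (fi w)); rewrite (V R rR _ (cocycle_comp hi cphi)) mul0mx.
Qed.

End LongExact.

Lemma ext_zero_retract M N N' i (f : homT N' N) (g : homT N N') :
  is_hom f -> is_hom g -> (forall w, f w *m g w = 1%:M) ->
  ext_zero M N i -> ext_zero M N' i.
Proof.
move=> hf hg fg V R rR phi cphi.
apply: coboundary_ext (coboundary_comp hg (V R rR _ (cocycle_comp hf cphi))) => w.
by rewrite -mulmxA fg mulmx1.
Qed.

(** * Mapping cones *)

Definition dsum (X Y : rep) : rep :=
  @Rep k n (fun w => rdim X w + rdim Y w)%N
    (fun p q => block_mx (rmap X p q) 0 0 (rmap Y p q)).

Lemma dsum_rep X Y : is_rep X -> is_rep Y -> is_rep (dsum X Y).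
Proof.
move=> [x1 [x2 x3]] [y1 [y2 y3]]; split=> [p|]; first by rewrite /= x1 y1 -scalar_mx_block.
split=> [p q r pq qr | p q pq] /=; last by rewrite x3 // y3 // block_mx0.
by rewrite mulmx_block !mulmx0 !mul0mx !addr0 add0r -x2 // -y2.
Qed.

Lemma hom_col X Y N (f : homT X N) (g : homT Y N) : is_hom f -> is_hom g ->
  is_hom (fun w => col_mx (f w) (g w) : 'M_(rdim (dsum X Y) w, rdim N w)).
Proof.
move=> hf hg p q pq /=.
by rewrite mul_block_col mul_col_mx !mul0mx addr0 add0r hf // hg.
Qed.

Lemma hom_row X Y N (f : homT N X) (g : homT N Y) : is_hom f -> is_hom g ->
  is_hom (fun w => row_mx (f w) (g w) : 'M_(rdim N w, rdim (dsum X Y) w)).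
Proof.
move=> hf hg p q pq /=.
by rewrite mul_mx_row mul_row_block !mulmx0 addr0 add0r hf // hg.
Qed.

Lemma hom_inl X Y : is_hom (fun w => row_mx 1%:M 0 : 'M_(rdim X w, rdim (dsum X Y) w)).
Proof. by apply: hom_row; [exact: hom_id | exact: hom_zero]. Qed.

Lemma hom_inr X Y : is_hom (fun w => row_mx 0 1%:M : 'M_(rdim Y w, rdim (dsum X Y) w)).
Proof. by apply: hom_row; [exact: hom_zero | exact: hom_id]. Qed.

Lemma dsum_proj X Y : is_proj X -> is_proj Y -> is_proj (dsum X Y).
Proof.
move=> [rX pX] [rY pY]; split; first exact: dsum_rep.
move=> M N g h rM rN hg sg hh.
have [l1 [hl1 E1]] := pX _ _ _ _ rM rN hg sg (hom_comp (@hom_inl X Y) hh).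
have [l2 [hl2 E2]] := pY _ _ _ _ rM rN hg sg (hom_comp (@hom_inr X Y) hh).
exists (fun w => col_mx (l1 w) (l2 w)); split=> [|w]; first exact: hom_col.
rewrite mul_col_mx -E1 -E2 -mul_col_mx -[LHS]mul1mx; congr (_ *m _).
by rewrite scalar_mx_block.
Qed.

Section Cone.
Variables (M' E M : rep) (iota : homT M' E) (pi : homT E M).
Hypothesis H : ses iota pi.
Variables (R' : projres M') (RE : projres E).
Hypotheses (rR' : is_projres R') (rRE : is_projres RE).
Variable f : forall i, homT (pr_mod R' i) (pr_mod RE i).
Hypotheses (cf : chain_map f)
  (f0 : forall w, f 0 w *m pr_eps RE w = pr_eps R' w *m iota w).

Definition cone_mod i : rep :=
  match i with 0 => pr_mod RE 0 | j.+1 => dsum (pr_mod RE j.+1) (pr_mod R' j) end.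

(** Vectors are rows, so the block rows belong to [RE] and then [R']; the sign makes consecutive
    differentials compose to zero. *)
Definition cone_d i : homT (cone_mod i.+1) (cone_mod i) :=
  match i return homT (cone_mod i.+1) (cone_mod i) with
  | 0 => fun w => col_mx (pr_d RE 0 w) (f 0 w)
  | j.+1 => fun w => block_mx (pr_d RE j.+1 w) 0 (f j.+1 w) (- pr_d R' j w)
  end.

Definition cone : projres M :=
  ProjRes (pr_mod := cone_mod) cone_d (fun w => pr_eps RE w *m pi w).

(** For exactness, the [R'] component of a cycle is lifted first; correcting by its image under [f]
    turns the [RE] component into a cycle, which lifts in turn. *)
Lemma cone_projres : is_projres cone.
Proof.
case: H => [[r' r r''] [hi hp fi sp ei]]; case: cf => hf ff.
split=> [[|i]|] /=; first exact: res_proj.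
  by apply: dsum_proj; exact: res_proj.
split=> [[|i]|] /=.
- by apply: hom_col => //; exact: res_hom.
- move=> p q pq /=; rewrite !mulmx_block !mulmx0 !mul0mx !addr0 !add0r.
  by rewrite mulmxN mulNmx !(res_hom rRE, res_hom rR') // hf.
split=> /=; first by apply: hom_comp => //; exact: res_eps.
split=> /=.
  move=> w; have := sp w; rewrite -!sub1mx => /submxP[D ->].
  by apply/submxMr/submx_full/res_surj.
split=> [w|[|i] w] /=.
- apply: exactI => [|m C].
    rewrite mul_col_mx !mulmxA res_deps // f0 mul0mx -[_ *m pi w]mulmxA.
    by rewrite (exact_comp0 (ei w)) mulmx0 col_mx0.
  rewrite mulmxA => /(exact_sub (ei w))/submxP[D DE].
  have sD : (D <= pr_eps R' w)%MS by apply: submx_full; exact: res_surj.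
  case/submxP: sD => D' D'E.
  have /(exact_sub (res_ex0 rRE w))/submxP[C' C'E] : (C - D' *m f 0%N w) *m pr_eps RE w = 0.
    by rewrite mulmxBl -mulmxA f0 mulmxA -D'E DE subrr.
  by apply/submxP; exists (row_mx C' D'); rewrite mul_row_col -C'E subrK.
- apply: exactI => [|m C].
    rewrite mul_block_col res_dd // mul0mx addr0 ff mulNmx subrr.
    by rewrite col_mx0.
  rewrite -[C]hsubmxK; set C1 := lsubmx C; set C2 := rsubmx C; rewrite mul_row_col => E0.
  (* Here injectivity of [iota] enters: it carries the augmentation of [C2] to that of a boundary,
     which is zero. *)
  have /(exact_sub (res_ex0 rR' w))/submxP[D DE] : C2 *m pr_eps R' w = 0.
    apply: (row_free_inj (fi w)); rewrite mul0mx -mulmxA -f0 mulmxA.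
    have -> : C2 *m f 0%N w = - (C1 *m pr_d RE 0 w) by apply/eqP; rewrite -addr_eq0 addrC E0.
    by rewrite mulNmx -mulmxA res_deps // mulmx0 oppr0.
  have /(exact_sub (res_exS rRE 0 w))/submxP[D' D'E] : (C1 + D *m f 1%N w) *m pr_d RE 0 w = 0.
    by rewrite mulmxDl -mulmxA ff mulmxA -DE.
  apply/submxP; exists (row_mx D' (- D)); rewrite mul_row_block mulmx0 add0r mulmxN !mulNmx opprK -D'E -DE.
  by rewrite addrK.
- apply: exactI => [|m C].
    rewrite mulmx_block !res_dd // !mul0mx !mulmx0 !addr0 ff mulNmx subrr mulNmx mulmxN res_dd //.
    by rewrite add0r !oppr0 block_mx0.
  rewrite -[C]hsubmxK; set C1 := lsubmx C; set C2 := rsubmx C; rewrite mul_row_block mulmx0 add0r.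
  rewrite -[0]row_mx0 => /eq_row_mx[E0 /eqP]; rewrite mulmxN oppr_eq0 => /eqP.
  move/(exact_sub (res_exS rR' i w))/submxP=> [D DE].
  have /(exact_sub (res_exS rRE i.+1 w))/submxP[D' D'E] :
      (C1 + D *m f i.+2 w) *m pr_d RE i.+1 w = 0.
    by rewrite mulmxDl -mulmxA ff mulmxA -DE.
  apply/submxP; exists (row_mx D' (- D)); rewrite mul_row_block mulmx0 add0r mulmxN !mulNmx opprK -D'E -DE.
  by rewrite addrK.
Qed.

End Cone.

(** As the terms of [RE] have no nonzero map to [N], cochains on the cone are cochains on [R'] moved
    up one degree, with differentials agreeing up to sign. *)
Lemma ext_zero_cone M' E M (iota : homT M' E) (pi : homT E M) (R' : projres M') (RE : projres E) N :
  ses iota pi -> is_projres R' -> is_projres RE ->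
  (forall i (phi : homT (pr_mod RE i) N), is_hom phi -> forall w, phi w = 0) ->
  ext_zero M N 0 /\ forall i, ext_zero M N i.+1 <-> ext_zero M' N i.
Proof.
move=> H rR' rRE HN; case: (H) => [[r' r r''] [hi hp fi sp ei]].
have [f [cf f0]] := chain_map_lift rR' rRE r hi.
have rC := cone_projres H rR' rRE cf f0.
split; first by apply: (ext_zeroI r'' rC) => phi [hphi _]; exact: HN.
have left0 i (phi : homT (cone_mod R' RE i.+1) N) : is_hom phi ->
    exists phi2 : homT (pr_mod R' i) N, is_hom phi2 /\ forall w, phi w = col_mx 0 (phi2 w).
  move=> hphi; exists (fun w => row_mx 0 1%:M *m phi w).
  split; first exact: (hom_comp (@hom_inr (pr_mod RE i.+1) (pr_mod R' i)) hphi).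
  move=> w; rewrite -[phi w in LHS]mul1mx (scalar_mx_block (rdim (pr_mod RE i.+1) w)).
  rewrite /block_mx mul_col_mx; congr col_mx.
  exact: (HN i.+1 _ (hom_comp (@hom_inl (pr_mod RE i.+1) (pr_mod R' i)) hphi)).
have right0 i (phi2 : homT (pr_mod R' i) N) : is_hom phi2 ->
    is_hom (fun w => col_mx 0 (phi2 w) : 'M_(rdim (cone_mod R' RE i.+1) w, rdim N w)).
  by move=> hphi; apply: hom_col => //; exact: hom_zero.
have d_col i (phi2 : homT (pr_mod R' i) N) w :
    cone_d f i.+1 w *m col_mx 0 (phi2 w) = col_mx 0 (- (pr_d R' i w *m phi2 w)).
  by rewrite /= mul_block_col !mul0mx mulmx0 !addr0 mulmx0 add0r mulNmx.
have col_inj w i (A B : 'M[k]_(rdim (pr_mod R' i) w, rdim N w)) :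
    col_mx (0 : 'M_(rdim (pr_mod RE i.+1) w, _)) A = col_mx 0 B -> A = B.
  by case/eq_col_mx.
have cyc i (phi : homT (cone_mod R' RE i.+1) N) (phi2 : homT (pr_mod R' i) N) :
    (forall w, phi w = col_mx 0 (phi2 w)) ->
    (forall w, cone_d f i.+1 w *m phi w = 0) <-> (forall w, pr_d R' i w *m phi2 w = 0).
  move=> E1; split=> Hz w.
    apply/eqP; rewrite -oppr_eq0; apply/eqP/(col_inj w i.+1).
    by rewrite -d_col -E1 Hz col_mx0.
  by rewrite E1 d_col Hz oppr0 col_mx0.
move=> i; split=> V.
  apply: (ext_zeroI r' rR') => phi [hphi zphi].
  have := V _ rC (fun w => col_mx 0 (phi w)) (conj (right0 i phi hphi) (proj2 (cyc i _ phi (fun w => erefl)) zphi)).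
  case: i phi hphi zphi V => [|i] phi hphi zphi V /= [Psi [hPsi EPsi]].
    by move=> w; apply: (col_inj w 0%N); rewrite EPsi (HN 0%N) // mulmx0 col_mx0.
  have [psi [hpsi Epsi]] := left0 i Psi hPsi.
  exists (fun w => - psi w); split=> [|w]; first exact: hom_opp.
  by apply: (col_inj w i.+1); rewrite EPsi Epsi mulmxN -d_col.
apply: (ext_zeroI r'' rC) => Phi [hPhi zPhi].
have [phi [hphi Ephi]] := left0 i Phi hPhi.
have := V _ rR' phi (conj hphi (proj1 (cyc i _ _ Ephi) zPhi)).
case: i Phi hPhi zPhi phi hphi Ephi V => [|i] Phi hPhi zPhi phi hphi Ephi V /= => [z0|[psi [hpsi Epsi]]].
  exists (fun w => 0); split=> [|w]; first exact: hom_zero.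
  by rewrite mulmx0 Ephi z0 col_mx0.
exists (fun w => col_mx 0 (- psi w)); split=> [|w]; first exact/right0/hom_opp.
have -> := d_col i (fun w => - psi w) w.
by rewrite Ephi Epsi mulmxN opprK.
Qed.

End HomologicalAlgebra.

Section Modules.
Variables (k : fieldType) (n : nat).
Local Notation P := {perm 'I_n}.
Local Notation le := (@bruhat n).
Local Notation len := (@coxlen n).
Local Notation rep := (rep k n).
Local Open Scope ring_scope.
Implicit Type S : P -> bool.

(** * Indicator modules of convex sets *)

Definition ind (S : P -> bool) : rep :=
  @Rep k n (fun q => S q : nat) (fun p q => const_mx (le q p)%:R).

Definition convex (S : P -> bool) : Prop :=
  forall p q r, le q p -> le r q -> S p -> S r -> S q.

(** Dimensions of indicator modules are booleans read as 0 or 1, so an index into a matrix serves as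
    a proof of membership. *)
Lemma ord_boolP (b : bool) (i : 'I_b) : b.
Proof. by case: b i => // -[]. Qed.

Lemma ord_bool_inj (b : bool) (i j : 'I_b) : i = j.
Proof. by case: b i j => [i j|[] //]; rewrite !ord1. Qed.

Lemma const_mx_bool (b : bool) : const_mx 1 = 1%:M :> 'M[k]_b.
Proof. by apply/matrixP=> i j; rewrite !mxE (ord_bool_inj i j) eqxx. Qed.

Lemma mul_const_mx_bool m1 (b : bool) m2 (x y : k) :
  (const_mx x : 'M_(m1, b)) *m (const_mx y : 'M_(b, m2)) = const_mx (x * y *+ b).
Proof.
apply/matrixP=> i j; rewrite !mxE (eq_bigr (fun=> x * y)) => [|l _]; last by rewrite !mxE.
by rewrite sumr_const card_ord.
Qed.

Lemma eq_const_mx_bool (b b' : bool) (x y : k) : (b -> b' -> x = y) ->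
  const_mx x = const_mx y :> 'M_(b, b').
Proof.
by move=> H; apply/matrixP=> i j; rewrite !mxE H ?(ord_boolP i) ?(ord_boolP j).
Qed.

Lemma ind_rep S : convex S -> is_rep (ind S).
Proof.
move=> cS; split=> [p|] /=; first by rewrite le_refl const_mx_bool.
split=> [p q r pq qr | p q /negbTE ->] /=; last by apply/matrixP=> i j; rewrite !mxE.
rewrite mul_const_mx_bool; apply: eq_const_mx_bool => Sp Sr.
by rewrite pq qr (le_trans qr pq) (cS p q r) // mulr1.
Qed.

Definition ind_map (S S' : P -> bool) : homT (ind S) (ind S') := fun w => const_mx 1.

Lemma ind_map_hom (S S' : P -> bool) :
  (forall p q, le q p -> S p -> S' q -> S q = S' p) -> is_hom (@ind_map S S').
Proof.
move=> H p q pq /=; rewrite !mul_const_mx_bool pq; apply: eq_const_mx_bool => Sp Sq.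
by rewrite !mulr1 (H p q).
Qed.

Lemma row_free_const_mx (b b' : bool) : (b -> b') -> row_free (const_mx 1 : 'M[k]_(b, b')).
Proof.
move=> H; apply/row_freeP; exists (const_mx 1); rewrite mul_const_mx_bool -const_mx_bool.
by apply: eq_const_mx_bool => /H -> _; rewrite mulr1.
Qed.

Lemma row_full_const_mx (b b' : bool) : (b' -> b) -> row_full (const_mx 1 : 'M[k]_(b, b')).
Proof.
move=> H; apply/row_fullP; exists (const_mx 1); rewrite mul_const_mx_bool -const_mx_bool.
by apply: eq_const_mx_bool => /H -> _; rewrite mulr1.
Qed.

(** Arrows descend in the Bruhat order, so a lower part of [S] spans a submodule and its complement
    the quotient. *)
Lemma ind_ses (S S' S'' : P -> bool) : convex S ->
  (forall x, S x = S' x || S'' x) -> (forall x, ~~ (S' x && S'' x)) ->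
  (forall x y, le y x -> S' x -> S y -> S' y) ->
  ses (@ind_map S' S) (@ind_map S S'').
Proof.
move=> cS US DS LS.
have S'S x : S' x -> S x by rewrite US => ->.
have S''S x : S'' x -> S x by rewrite US orbC => ->.
have S''E x : S'' x = S x && ~~ S' x.
  by rewrite US; have := DS x; case: (S' x); case: (S'' x).
split; first split; try apply: ind_rep => //.
- move=> p q r pq qr Sp Sr; apply: (LS p) => //; apply: (cS p q r); auto.
- move=> p q r pq qr; rewrite !S''E => /andP[Sp nSp] /andP[Sr nSr].
  rewrite (cS p q r) //=; apply: contra nSr => Sq; exact: (LS q).
split.
- by apply: ind_map_hom => p q pq Sp Sq; rewrite (S'S p) // (LS p).
- apply: ind_map_hom => p q pq Sp; rewrite !S''E => /andP[Sq nSq].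
  by rewrite Sq Sp /=; apply/esym; apply: contra nSq => Sp'; exact: (LS p).
- by move=> w; exact/row_free_const_mx/S'S.
- by move=> w; exact/row_full_const_mx/S''S.
move=> w; apply: exactI => [|m C].
  rewrite mul_const_mx_bool mulr1; apply/matrixP=> i j; rewrite !mxE.
  by have := ord_boolP i; have := ord_boolP j; have := DS w => /[swap] -> /[swap] ->.
(* On [S'] the inclusion is onto; off [S'] the projection is injective, so the kernel vector is
   zero. *)
move=> H; have [S'w|nS'w] := boolP (S' w).
  by apply/submx_full/row_full_const_mx.
have := H; move/(congr1 (fun A => A *m (const_mx 1 : 'M_(_, S w)))).
rewrite -mulmxA mul_const_mx_bool mul0mx mulr1 => e.
rewrite (_ : C = 0) ?sub0mx // -e -[LHS]mulmx1 -const_mx_bool; congr (_ *m _).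
by apply: eq_const_mx_bool => Sw _; rewrite S''E Sw nS'w.
Qed.

Lemma simple_modE w : simple_mod k w = ind (fun q => q == w).
Proof.
rewrite /simple_mod /ind; congr Rep.
apply: functional_extensionality_dep => p; apply: functional_extensionality_dep => q.
apply/matrixP=> i j; rewrite !mxE (eqP (ord_boolP i)) (eqP (ord_boolP j)).
by rewrite eqxx le_refl.
Qed.

Lemma convex1 w : convex (fun q => q == w).
Proof. by move=> p q r pq qr /eqP e1 /eqP e2; subst; apply/eqP/le_anti. Qed.

Lemma convex_lower S : (forall x y, le y x -> S x -> S y) -> convex S.
Proof. by move=> H p q r pq qr Sp _; exact: H pq Sp. Qed.

(** * Free modules *)

Section Free.
Variables (T : finType) (f : T -> P).

(** A generator at [f t] contributes one basis vector at each vertex below [f t]. *)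
Definition gens q : {set T} := [set t | le q (f t)].

Definition gens_sel p q : 'M[k]_(#|gens p|, #|gens q|) :=
  \matrix_(i, j) (enum_val i == enum_val j)%:R.

Definition free_mod : rep :=
  @Rep k n (fun q => #|gens q|) (fun p q => if le q p then gens_sel p q else 0).

Lemma gens_le p q : le q p -> gens p \subset gens q.
Proof. by move=> qp; apply/subsetP=> t; rewrite !inE; exact: le_trans. Qed.

Lemma gens_sub p q t : gens p \subset gens q -> t \in gens p -> t \in gens q.
Proof. by move/subsetP; apply. Qed.

Lemma row_gens_sel p q m (A : 'M_(#|gens q|, m)) (i : 'I_#|gens p|)
    (h : enum_val i \in gens q) :
  row i (gens_sel p q *m A) = row (enum_rank_in h (enum_val i)) A.
Proof.
rewrite row_mul [RHS]rowE; congr (_ *m _); apply/rowP=> j; rewrite !mxE eqxx /=.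
have -> // : (enum_val i == enum_val j) = (j == enum_rank_in h (enum_val i)).
by apply/eqP/eqP => [e|->]; [apply: enum_val_inj | ]; rewrite enum_rankK_in.
Qed.

Lemma gens_selM p q r : gens p \subset gens q ->
  gens_sel p q *m gens_sel q r = gens_sel p r.
Proof.
move=> pq; apply/row_matrixP=> i.
rewrite (row_gens_sel _ (gens_sub pq (enum_valP i))).
by apply/rowP=> j; rewrite !mxE enum_rankK_in ?(gens_sub pq) ?enum_valP.
Qed.

Lemma gens_sel1 p : gens_sel p p = 1%:M.
Proof. by apply/matrixP=> i j; rewrite !mxE (inj_eq enum_val_inj). Qed.

Lemma free_rep : is_rep free_mod.
Proof.
split=> [p|] /=; first by rewrite le_refl gens_sel1.
split=> [p q r pq qr | p q /negbTE ->] //=.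
by rewrite pq qr (le_trans qr pq) gens_selM ?gens_le.
Qed.

Lemma gens_self t : t \in gens (f t). Proof. by rewrite inE le_refl. Qed.

(** Every basis vector is the image of its generator under a structure map, so a homomorphism is
    determined by its values on generators. *)
Lemma hom_free_row (N : rep) (h : homT free_mod N) q (i : 'I_#|gens q|) : is_hom h ->
  row i (h q) = row (enum_rank_in (gens_self (enum_val i)) (enum_val i)) (h (f (enum_val i)))
                *m rmap N (f (enum_val i)) q.
Proof.
move=> hh; set t := enum_val i.
have qt : le q (f t) by have := enum_valP i; rewrite inE.
rewrite -row_mul -hh //= qt.
have ht : enum_val (enum_rank_in (gens_self t) t) \in gens q.
  by rewrite enum_rankK_in ?gens_self ?enum_valP.
rewrite (row_gens_sel _ ht); congr row; apply: enum_val_inj.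
by rewrite !enum_rankK_in ?gens_self ?enum_valP.
Qed.

Lemma hom_free_zero (N : rep) (h : homT free_mod N) : is_hom h ->
  (forall t, rdim N (f t) = 0%N) -> forall w, h w = 0.
Proof.
move=> hh z w; apply/row_matrixP=> i; rewrite hom_free_row // row0.
move: (row _ (h _)) (rmap N _ _); rewrite z => A B; by rewrite thinmx0 mul0mx.
Qed.

Definition free_hom (N : rep) (u : forall t, 'rV[k]_(rdim N (f t))) : homT free_mod N :=
  fun q => \matrix_(i < #|gens q|) (u (enum_val i) *m rmap N (f (enum_val i)) q).

Lemma free_hom_hom (N : rep) u : is_rep N -> is_hom (@free_hom N u).
Proof.
move=> [_ [N2 _]] p q qp /=; rewrite qp; apply/row_matrixP=> i.
have h := gens_sub (gens_le qp) (enum_valP i).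
rewrite (row_gens_sel _ h) row_mul !rowK enum_rankK_in //.
have pt : le p (f (enum_val i)) by have := enum_valP i; rewrite inE.
by rewrite -mulmxA -N2.
Qed.

Lemma free_proj : is_proj free_mod.
Proof.
split; first exact: free_rep.
move=> M N g h rM rN hg sg hh.
pose e t := row (enum_rank_in (gens_self t) t) (h (f t)).
pose u t := e t *m pinvmx (g (f t)).
exists (free_hom u); split; first exact: free_hom_hom.
move=> w; apply/row_matrixP=> i; rewrite hom_free_row // row_mul rowK.
have qt : le w (f (enum_val i)) by have := enum_valP i; rewrite inE.
by rewrite -mulmxA hg // mulmxA mulmxKpV // submx_full.
Qed.

End Free.

(** * Resolutions compatible with a closure operator *)

Section Closure.
Variable c : P -> P.
Hypotheses (c_ge : forall x, le x (c x)) (c_mono : forall x y, le x y -> le (c x) (c y))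
  (c_idem : forall x, c (c x) = c x).

Definition closure_invariant (M : rep) : Prop :=
  forall x, row_free (rmap M (c x) x) /\ row_full (rmap M (c x) x).

(** One generator per basis vector of [M] at [y], but placed at the closed vertex [c y]; invariance
    of [M] provides the preimage to send it to. *)
Definition cover_mod (M : rep) : rep :=
  @free_mod {y : P & 'I_(rdim M y)} (fun t => c (tag t)).

Definition cover (M : rep) : homT (cover_mod M) M :=
  @free_hom {y : P & 'I_(rdim M y)} (fun t => c (tag t)) M
    (fun t => row (tagged t) (pinvmx (rmap M (c (tag t)) (tag t)))).

Lemma cover_hom M : is_rep M -> is_hom (cover M).
Proof. exact: free_hom_hom. Qed.

Lemma cover_surj M : closure_invariant M -> is_surj (cover M).
Proof.
move=> iM y; rewrite -sub1mx; apply/row_subP=> a.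
pose t : {y : P & 'I_(rdim M y)} := Tagged (fun y => 'I_(rdim M y)) a.
have ht : t \in gens (fun t : {y : P & 'I_(rdim M y)} => c (tag t)) y by rewrite inE c_ge.
apply: submx_trans (row_sub (enum_rank_in ht t) _).
rewrite rowK enum_rankK_in //=.
by rewrite -row_mul mulVpmx //; case: (iM y).
Qed.

Lemma cover_mod_invariant M : closure_invariant (cover_mod M).
Proof.
move=> x; rewrite /= c_ge.
have E : gens (fun t : {y : P & 'I_(rdim M y)} => c (tag t)) (c x) = gens (fun t => c (tag t)) x.
  apply/setP=> t; rewrite !inE; apply/idP/idP; first exact: le_trans (c_ge x).
  by move/c_mono; rewrite c_idem.
split; [apply/row_freeP | apply/row_fullP]; exists (gens_sel _ x (c x));
  by rewrite gens_selM ?gens_sel1 ?E.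
Qed.

(** Injectivity is inherited from [M]. For surjectivity, lift a kernel vector from [x] to [c x] in
    [M]; the lift stays in the kernel because [N] is injective from [c x] to [x]. *)
Lemma ker_rep_invariant (M N : rep) (g : homT M N) : is_rep M -> is_rep N -> is_hom g ->
  closure_invariant M -> closure_invariant N -> closure_invariant (ker_rep g).
Proof.
move=> rM rN hg iM iN x; have [f1 f2] := iM x; have [f3 f4] := iN x.
have hi := ker_inc_hom hg (c_ge x).
split.
  rewrite -kermx_eq0; apply/eqP.
  have z : kermx (rmap (ker_rep g) (c x) x) *m ker_inc g (c x) *m rmap M (c x) x = 0.
    by rewrite -mulmxA -hi mulmxA mulmx_ker mul0mx.
  apply: (row_free_inj (ker_inc_free g (c x))); apply: (row_free_inj f1).
  by rewrite z !mul0mx.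
have : (ker_inc g x <= rmap M (c x) x)%MS by exact: submx_full.
case/submxP=> y yE.
have /(exact_sub (ker_inc_exact g (c x)))/submxP[z zE] : y *m g (c x) = 0.
  apply: (row_free_inj f3).
  by rewrite -mulmxA -hg // mulmxA -yE (exact_comp0 (ker_inc_exact g x)) mul0mx.
apply/row_fullP; exists z; apply: (row_free_inj (ker_inc_free g x)).
by rewrite -mulmxA hi mulmxA -zE -yE mul1mx.
Qed.

Fixpoint syzygy (M : rep) i : rep :=
  match i with 0 => M | j.+1 => ker_rep (cover (syzygy M j)) end.

Lemma syzygyP M i : is_rep M -> closure_invariant M ->
  is_rep (syzygy M i) /\ closure_invariant (syzygy M i).
Proof.
move=> rM iM; elim: i => //= i [rK iK].
have hg := cover_hom rK; have rF := free_rep (fun t : {y : P & 'I_(rdim (syzygy M i) y)} => c (tag t)).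
split; first exact: ker_rep_rep.
by apply: ker_rep_invariant => //; exact: cover_mod_invariant.
Qed.

Definition cover_res (M : rep) : projres M :=
  @ProjRes k n M (fun i => cover_mod (syzygy M i))
    (fun i w => cover (syzygy M i.+1) w *m ker_inc (cover (syzygy M i)) w)
    (cover M).

Lemma cover_res_projres M : is_rep M -> closure_invariant M -> is_projres (cover_res M).
Proof.
move=> rM iM.
have rK i := proj1 (@syzygyP M i rM iM); have iK i := proj2 (@syzygyP M i rM iM).
have hc i := cover_hom (rK i); have sc i := cover_surj (iK i).
have ex i w : (pr_d (cover_res M) i w == kermx (cover (syzygy M i) w))%MS.
  have e : (pr_d (cover_res M) i w :=: ker_inc (cover (syzygy M i)) w)%MS.
    by apply: eqmxMfull; exact: (sc i.+1).
  by apply/eqmxP/(eqmx_trans e)/eqmxP/ker_inc_exact.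
have fi i w := ker_inc_free (cover (syzygy M i)) w.
split=> [i|]; first exact: free_proj.
split=> [i|] /=; first exact: (hom_comp (hc i.+1) (ker_inc_hom (hc i))).
split=> /=; first exact: hc 0%N.
split=> /=; first exact: sc 0%N.
split=> [w|i w]; first exact: (ex 0%N).
(* Composing the cover with the injective kernel inclusion does not change its kernel. *)
apply/eqmxP; apply: eqmx_trans (eqmxP (ex i.+1 w)) _; apply/eqmxP.
by rewrite /= !sub_kermx mulmxA mulmx_ker mul0mx eqxx /=; apply/eqP/(row_free_inj (fi i w));
  rewrite -mulmxA mulmx_ker mul0mx.
Qed.

Lemma invariant_resolution M : is_rep M -> closure_invariant M ->
  exists2 R : projres M, is_projres R &
    forall i (N : rep) (h : homT (pr_mod R i) N), is_hom h ->
      (forall y, rdim N (c y) = 0%N) -> forall w, h w = 0.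
Proof.
move=> rM iM; exists (cover_res M); first exact: cover_res_projres.
by move=> i N h hh z; apply: hom_free_zero => // t; exact: z.
Qed.

End Closure.

(* A surjection from a free module on a basis of each [M_y] is an isomorphism
   at the maximal points of the support, so the support of the syzygies
   loses one unit of length at each step. *)
Lemma syzygy_support w i x : rdim (syzygy id (ind (fun q => q == w)) i) x <> 0%N ->
  le x w /\ (len x + i <= len w)%N.
Proof.
elim: i x => [|i IH] x /=.
  by case: eqP => // -> _; rewrite le_refl addn0.
set M := syzygy id _ i in IH *.
have ge_id y : le y (id y) := le_refl y.
have [rM iM] : is_rep M /\ closure_invariant id M.
  apply: syzygyP => //; first exact/ind_rep/convex1.
  by move=> y /=; rewrite le_refl const_mx_bool row_free_unit row_full_unit unitmx1.
move=> nz.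
set f := fun t : {y : P & 'I_(rdim M y)} => id (tag t).
have lw y (a : 'I_(rdim M y)) : le y w /\ (len y + i <= len w)%N.
  by apply: IH => e; move: a; rewrite e => -[].
(* A generator strictly above [x] yields the bound with one unit to spare. Otherwise all generators
   seen at [x] sit at [x], are at most as many as the dimension of [M] there, and the cover has no
   kernel at [x]. *)
have [/existsP[t /andP[tx nx]]|H] := boolP [exists t, (t \in gens f x) && (tag t != x)].
  case: t tx nx => y a; rewrite inE /f /= => xy nyx.
  have [yw yl] := lw y a; split; first exact: le_trans yw.
  by case: (le_len xy) => [e|]; [rewrite e eqxx in nyx | lia].
case: nz; apply/eqP; rewrite mxrank_ker.
have /eqP -> := cover_surj ge_id iM x.
rewrite subn_eq0 /=.
have -> : rdim M x = #|[set Tagged (fun y => 'I_(rdim M y)) a | a : 'I_(rdim M x)]|.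
  rewrite card_imset ?card_ord // => a b /eqP; rewrite eq_Tagged => /eqP; exact.
apply/subset_leq_card/subsetP=> -[y a] ty; apply/imsetP.
have e : y = x.
  by apply: contraNeq H => e; apply/existsP; exists (existT _ y a); rewrite ty.
by subst y; exists a.
Qed.

(** Take the cover resolution for [c = id]: its generators sit where the syzygies live, and
    [syzygy_support] leaves none beyond degree [len w]. *)
Lemma simple_resolution w :
  exists2 R : projres (ind (fun q => q == w)), is_projres R &
    (forall i (N : rep) (h : homT (pr_mod R i) N), is_hom h ->
      (forall y, le y w -> (len y + i <= len w)%N -> rdim N y = 0%N) -> forall x, h x = 0) /\
    (forall i, (len w < i)%N -> is_zero_mod (pr_mod R i)).
Proof.
have ge_id y : le y (id y) := le_refl y.
exists (cover_res id (ind (fun q => q == w))).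
  apply: cover_res_projres => //; first exact/ind_rep/convex1.
  by move=> y /=; rewrite le_refl const_mx_bool row_free_unit row_full_unit unitmx1.
have sup i (t : {y : P & 'I_(rdim (syzygy id (ind (fun q => q == w)) i) y)}) :
    le (tag t) w /\ (len (tag t) + i <= len w)%N.
  by apply: syzygy_support => e; case: t e => y a /= e; move: a; rewrite e => -[].
split=> [i N h hh z | i wi x].
  by apply: hom_free_zero => // t; have [] := sup i t; exact: z.
apply/eqP; rewrite cards_eq0; apply/eqP/setP=> t; rewrite !inE.
by have [_] := sup i t; lia.
Qed.

(** * Pulling back along cosets of a simple reflection *)

Definition pull (g : P -> P) (M : rep) : rep :=
  @Rep k n (fun x => rdim M (g x)) (fun p q => if le q p then rmap M (g p) (g q) else 0).

Section Pull.
Variable g : P -> P.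
Hypothesis g_mono : forall x y, le x y -> le (g x) (g y).

Lemma pull_rep M : is_rep M -> is_rep (pull g M).
Proof.
move=> [r1 [r2 r3]]; split=> [p|] /=; first by rewrite le_refl r1.
split=> [p q r pq qr | p q /negbTE ->] //=.
by rewrite pq qr (le_trans qr pq) (r2 (g p) (g q)) ?g_mono.
Qed.

Lemma pull_hom M N (h : homT M N) : is_hom h ->
  is_hom (fun x => h (g x) : 'M_(rdim (pull g M) x, rdim (pull g N) x)).
Proof. by move=> hh p q pq /=; rewrite pq hh ?g_mono. Qed.

End Pull.

Section Coset.
Variable s : P.
Hypothesis ss : simple s.
Local Notation o := (cmin s).
Local Notation c := (cmax s).

Lemma cmax_idem x : c (c x) = c x.
Proof. by rewrite cmax_desc // len_cmax. Qed.

(* [pull o] has the exact right adjoint [pull c], because [o x <= y] iff [x <= c y]. *)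
Lemma pull_cmin_proj Q : is_proj Q -> is_proj (pull o Q).
Proof.
move=> [rQ pQ]; have omono := cmin_mono ss; have cmono := cmax_mono ss.
split; first exact: pull_rep.
case: (rQ) => [q1 [q2 q3]].
move=> M N g h rM rN hg sg hh.
have oc x : le (o (c x)) x by rewrite (cmin_max ss) (cmin_le ss).
have xco x : le x (c (o x)) by rewrite (cmax_min ss) (cmax_ge ss).
(* The transpose of [h]; its lift [l'] is transposed back below. *)
pose h' : homT Q (pull c N) := fun x => rmap Q x (o (c x)) *m h (c x).
have hh' : is_hom h'.
  move=> p q pq /=; rewrite pq /h' mulmxA -q2 // -mulmxA -hh ?cmono //= cmono //.
  by rewrite mulmxA -q2 // omono ?cmono.
have sg' : is_surj (fun x => g (c x) : 'M_(rdim (pull c M) x, rdim (pull c N) x)).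
  by move=> x; exact: sg.
have [l' [hl' El']] := pQ _ _ _ _ (pull_rep cmono rM) (pull_rep cmono rN)
  (pull_hom cmono hg) sg' hh'.
case: (rM) => [m1 [m2 m3]].
exists (fun x => l' (o x) *m rmap M (c (o x)) x); split.
  move=> p q pq /=; rewrite pq mulmxA hl' ?omono //= omono // -!mulmxA -!m2 ?xco ?cmono ?omono //.
move=> x; rewrite -mulmxA hg // mulmxA -El' /h' -mulmxA -hh //= xco.
rewrite mulmxA -(q2 (o x) (o (c (o x))) (o x) (oc (o x)) (omono _ _ (xco x))).
by rewrite q1 mul1mx.
Qed.

Definition pull_res M (R : projres M) : projres (pull o M) :=
  @ProjRes k n (pull o M) (fun i => pull o (pr_mod R i))
    (fun i x => pr_d R i (o x)) (fun x => pr_eps R (o x)).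

Lemma pull_projres M (R : projres M) : is_projres R -> is_projres (pull_res R).
Proof.
move=> rR; have omono := cmin_mono ss.
split=> [i|] /=; first exact/pull_cmin_proj/res_proj.
split=> [i|] /=; first exact/(pull_hom omono)/res_hom.
split=> /=; first exact/(pull_hom omono)/res_eps.
split=> [w|] /=; first exact: res_surj.
by split=> [w | i w] /=; [exact: res_ex0 | exact: res_exS].
Qed.

Definition coset_invariant (N : rep) : Prop :=
  forall x, row_free (rmap N x (o x)) /\ row_full (rmap N x (o x)).

(** Invariance of [N] turns [phi] into a cocycle on the pulled-back resolution. That one resolves
    zero, so the cocycle bounds, and composing with the natural map from [R] recovers [phi]. *)
Lemma ext_zero_invariant M N i : is_rep M -> is_rep N -> coset_invariant N ->
  is_zero_mod (pull o M) -> ext_zero M N i.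
Proof.
move=> rM rN iN zM R rR phi [hphi zphi]; have omono := cmin_mono ss; have ole := cmin_le ss.
have [n1 [n2 n3]] := rN.
have pinvC p q : le q p -> pinvmx (rmap N p (o p)) *m rmap N p q
    = rmap N (o p) (o q) *m pinvmx (rmap N q (o q)).
  move=> qp; apply: (row_free_inj (proj1 (iN q))).
  rewrite -mulmxA -n2 // -[RHS]mulmxA mulVpmx ?(proj2 (iN q)) // mulmx1.
  by rewrite (n2 p (o p) (o q)) ?omono // mulmxA mulVpmx ?(proj2 (iN p)) // mul1mx.
pose phi' : homT (pull o (pr_mod R i)) N := fun x => phi (o x) *m pinvmx (rmap N x (o x)).
have hphi' : is_hom phi'.
  by move=> p q qp /=; rewrite qp /phi' mulmxA hphi ?omono // -mulmxA -pinvC // mulmxA.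
have rp := pull_projres rR.
have cphi' : cocycle (R := pull_res R) (i := i) phi'.
  by split=> [|x] /=; [exact: hphi' | rewrite /phi' mulmxA zphi mul0mx].
have V := ext_zero_zero (pull_rep omono rM) zM rp cphi'.
have eta_hom j : is_hom (fun x => rmap (pr_mod R j) x (o x) :
    'M_(rdim (pr_mod R j) x, rdim (pull o (pr_mod R j)) x)).
  have [_ [r2 _]] := res_rep rR j.
  by move=> p q qp /=; rewrite qp -!r2 ?omono.
have phiE x : phi x = rmap (pr_mod R i) x (o x) *m phi' x.
  by rewrite /phi' mulmxA hphi // -mulmxA mulmxVp ?(proj1 (iN x)) // mulmx1.
case: i phi hphi zphi phi' hphi' cphi' V phiE => [|i] phi hphi zphi phi' hphi' cphi' /= V phiE.
  by move=> x; rewrite phiE V mulmx0.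
case: V => psi [hpsi E].
exists (fun x => rmap (pr_mod R i) x (o x) *m psi x); split.
  exact: (hom_comp (eta_hom i) hpsi).
by move=> x; rewrite phiE E !mulmxA (res_hom rR i).
Qed.

Lemma lower_invariant S : (forall x, S (c x) = S x) -> (forall x y, le y x -> S x -> S y) ->
  coset_invariant (ind S).
Proof.
move=> Sc Sl x; have e : S (o x) = S x by rewrite -Sc (cmax_min ss) Sc.
rewrite /= (cmin_le ss); split; [apply: row_free_const_mx | apply: row_full_const_mx];
  by rewrite e.
Qed.

(** The element [w] is never a coset minimum, so its simple module pulls back to zero. *)
Lemma ext_zero_descent w S i : (len (w * s)%g < len w)%N ->
  (forall x, S (c x) = S x) -> (forall x y, le y x -> S x -> S y) ->
  ext_zero (ind (fun q => q == w)) (ind S) i.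
Proof.
move=> ws Sc Sl; apply: ext_zero_invariant.
- exact/ind_rep/convex1.
- exact/ind_rep/convex_lower.
- exact: lower_invariant.
- by move=> x /=; case: eqP => // e; have := len_cmin ss x; rewrite e; lia.
Qed.

Lemma coset_ses w : (len (w * s)%g < len w)%N ->
  ses (@ind_map (fun q => q == (w * s)%g) (fun q => c q == w))
      (@ind_map (fun q => c q == w) (fun q => q == w)).
Proof.
move=> ws; have cw := cmax_desc ws.
have fib x : (c x == w) = (x == (w * s)%g) || (x == w).
  apply/eqP/orP => [e | [/eqP -> | /eqP ->] //]; last by rewrite (cmax_mul ss).
  case: (cmax_cases s x); rewrite e => e'; [right | left]; rewrite e' ?eqxx //.
  by rewrite (mulKsimple _ ss).
apply: ind_ses.
- move=> p q r pq qr /eqP e1 /eqP e2; apply/eqP/le_anti.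
    by rewrite -e1 (cmax_mono ss).
  by rewrite -e2 (cmax_mono ss).
- exact: fib.
- by move=> x; apply/negP=> /andP[/eqP -> /eqP e]; move: ws; rewrite e ltnn.
- move=> x y yx /eqP xE; rewrite fib => /orP[// | /eqP yE].
  by have := le_leq_len yx; rewrite xE yE; lia.
Qed.

(* First-variable dimension shift along [0 -> L_ws -> E -> L_w -> 0], where
   [E] has a resolution by projectives generated at maximal coset
   representatives. *)
Lemma ext_zero_shift w N : (len (w * s)%g < len w)%N -> (forall y, rdim N (c y) = 0%N) ->
  ext_zero (ind (fun q => q == w)) N 0 /\
  forall i, ext_zero (ind (fun q => q == w)) N i.+1 <->
            ext_zero (ind (fun q => q == (w * s)%g)) N i.
Proof.
move=> ws zN; have H := coset_ses ws.
have [R' rR' _] := simple_resolution (w * s)%g.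
have [[_ rE _] _] := H.
have iE : closure_invariant c (ind (fun q => c q == w)).
  move=> x; rewrite /= (cmax_ge ss).
  by split; [apply: row_free_const_mx | apply: row_full_const_mx]; rewrite cmax_idem.
have [RE rRE zRE] := invariant_resolution (cmax_ge ss) (cmax_mono ss) cmax_idem rE iE.
by apply: (ext_zero_cone H rR' rRE) => i phi hphi; exact: zRE.
Qed.

End Coset.
End Modules.

(** * Projectives as indicator modules of lower intervals *)

Section Perfection.
Variables (k : fieldType) (n : nat).
Local Notation P := {perm 'I_n}.
Local Notation le := (@bruhat n).
Local Notation len := (@coxlen n).
Local Notation rep := (rep k n).
Local Notation L w := (ind k (fun q : P => q == w)).
Local Notation Pr v := (ind k (fun q : P => le q v)).
Implicit Types (v w x y s : P) (J : {set 'I_n}).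
Local Open Scope ring_scope.

Lemma len_eq0 x : len x = 0%N -> x = 1%g.
Proof. by move=> x0; apply/eqP; apply: contraT => /exists_descent[i _]; rewrite x0. Qed.

Lemma ind_ext (S S' : P -> bool) : S =1 S' -> ind k S = ind k S'.
Proof. by move=> e; congr ind; exact: functional_extensionality_dep. Qed.

Lemma Pr1 : Pr 1%g = L 1%g.
Proof.
apply: ind_ext => x; apply/idP/eqP => [|->]; last exact: le_refl.
by move=> H; apply: (le_anti H); exact: le1g.
Qed.

Lemma lower_le v x y : le y x -> le x v -> le y v.
Proof. exact: le_trans. Qed.

(** Lower intervals of coset maxima are thus unions of cosets, as [ext_zero_descent] requires. *)
Lemma le_cmax s v x : simple s -> cmax s v = v -> le (cmax s x) v = le x v.
Proof.
move=> ss cv; apply/idP/idP; first exact: le_trans (cmax_ge ss x).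
by move/(cmax_mono ss); rewrite cv.
Qed.

Lemma le_ses v (S : P -> bool) : (forall x, S x -> le x v) ->
  (forall x y, le y x -> S x -> S y) ->
  ses (@ind_map k n S (fun q => le q v)) (@ind_map k n (fun q => le q v) (fun q => le q v && ~~ S q)).
Proof.
move=> Sv Sl; apply: ind_ses; first exact/convex_lower/lower_le.
- by move=> x; case: (boolP (S x)) => [/Sv -> //|]; rewrite andbT.
- by move=> x; case: (S x); rewrite ?andbF.
- by move=> x y yx Sx _; exact: Sl yx Sx.
Qed.

(** * Ext from simple modules *)

Lemma ext_zero_support w (N : rep) i :
  (forall y, le y w -> (len y + i <= len w)%N -> rdim N y = 0%N) -> ext_zero (L w) N i.
Proof.
move=> z; have [R rR [RN _]] := simple_resolution k w.
apply: (ext_zeroI (ind_rep _ (@convex1 n w)) rR) => phi [hphi _].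
have phi0 := RN i N phi hphi z.
exact: coboundary_ext (fun x => esym (phi0 x)) (coboundary_zero R N i).
Qed.

Lemma not_ext_zero_self w : ~ ext_zero (L w) (L w) 0.
Proof.
move=> V; have [R rR _] := simple_resolution k w.
have := V R rR (pr_eps R) (conj (res_eps rR) (fun x => res_deps rR x)) w.
by have := res_surj rR w => /[swap] ->; rewrite /row_full mxrank0 /= eqxx.
Qed.

(** The identity is never a coset maximum, so each descent of [w] shifts the degree by one, down to
    [w = 1], where only Hom survives. *)
Lemma ext_zero_bottom w i : ext_zero (L w) (L 1%g) i <-> i <> len w.
Proof.
move: {2}(len w) (erefl (len w)) => m; elim: m w i => [|m IH] w i wm.
  rewrite wm (len_eq0 wm); case: i => [|i]; split=> //; first by move/not_ext_zero_self.
  by move=> _; apply: ext_zero_support => y _; rewrite len1; lia.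
have [w1|/exists_descent[a Ha Hw]] := eqVneq w 1%g; first by rewrite w1 len1 in wm.
have ss := simple_sref Ha.
have [|V0 VS] := @ext_zero_shift k n (sref a) ss w (L 1%g) Hw.
  by move=> y /=; case: eqP => // e; have := len_cmax ss y; rewrite e len1.
rewrite wm; case: i => [|i]; first by split.
have lws : len (w * sref a)%g = m by have := len_simple w ss; lia.
rewrite VS IH // lws; split; lia.
Qed.

(** * Decomposition of free modules into indicator projectives *)

Section FreeSummands.
Variables (T : finType) (f : T -> P).

Definition free_proj_map t : homT (free_mod k f) (Pr (f t)) :=
  fun q => \matrix_(i < #|gens f q|, j < le q (f t)) (enum_val i == t)%:R.

Definition free_inc_map t : homT (Pr (f t)) (free_mod k f) :=
  fun q => \matrix_(i < le q (f t), j < #|gens f q|) (enum_val j == t)%:R.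

Lemma free_proj_map_hom t : is_hom (free_proj_map t).
Proof.
move=> p q qp /=; rewrite qp; apply/row_matrixP=> i.
have h := gens_sub (gens_le f qp) (enum_valP i).
rewrite (row_gens_sel _ h) row_mul; apply/rowP=> j; rewrite !mxE enum_rankK_in //.
rewrite (eq_bigr (fun=> (enum_val i == t)%:R)) => [|l _]; last by rewrite !mxE mulr1.
rewrite sumr_const card_ord; case: eqP => [e|_]; last by rewrite mul0rn.
by have := enum_valP i; rewrite inE e => ->.
Qed.

Lemma free_inc_map_hom t : is_hom (free_inc_map t).
Proof.
move=> p q qp /=; rewrite qp; apply/matrixP=> i j; rewrite !mxE.
have pt : le p (f t) := ord_boolP i.
have tp : t \in gens f p by rewrite inE.
rewrite (eq_bigr (fun=> (enum_val j == t)%:R)) => [|l _]; last by rewrite !mxE mul1r.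
rewrite sumr_const card_ord (le_trans qp pt) (bigD1 (enum_rank_in tp t)) //=.
rewrite big1 ?addr0 => [|l lt]; rewrite !mxE.
  by rewrite enum_rankK_in // eqxx mul1r eq_sym.
rewrite (_ : enum_val l == t = false) ?mul0r //; apply: contraNF lt => /eqP e.
by apply/eqP/enum_val_inj; rewrite e enum_rankK_in.
Qed.

Lemma free_incK t q : free_inc_map t q *m free_proj_map t q = 1%:M.
Proof.
apply/matrixP=> i j; rewrite !mxE (ord_bool_inj i j) eqxx.
have tq : t \in gens f q by rewrite inE (ord_boolP i).
rewrite (bigD1 (enum_rank_in tq t)) //= big1 ?addr0 => [|l lt]; rewrite !mxE.
  by rewrite enum_rankK_in // eqxx mul1r.
rewrite (_ : enum_val l == t = false) ?mul0r //; apply: contraNF lt => /eqP e.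
by apply/eqP/enum_val_inj; rewrite e enum_rankK_in.
Qed.

Lemma free_sum q : \sum_t free_proj_map t q *m free_inc_map t q = 1%:M.
Proof.
apply/matrixP=> i j; rewrite summxE mxE (bigD1 (enum_val i)) //= big1 ?addr0 => [|t ti].
  rewrite mxE (eq_bigr (fun=> (i == j)%:R)) => [|l _].
    by rewrite sumr_const card_ord; have := enum_valP i; rewrite inE => ->.
  by rewrite !mxE eqxx mul1r (inj_eq enum_val_inj) eq_sym.
by rewrite mxE big1 // => l _; rewrite !mxE eq_sym (negbTE ti) mul0r.
Qed.

(** Each projective is a retract of the free module, and by [free_sum] a cocycle is the finite sum
    of its components. *)
Lemma ext_zero_free M i :
  ext_zero M (free_mod k f) i <-> forall t, ext_zero M (Pr (f t)) i.
Proof.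
split=> [V t | V R rR phi cphi].
  apply: (ext_zero_retract _ _ _ V).
  - exact: free_inc_map_hom.
  - exact: free_proj_map_hom.
  - exact: free_incK.
have H (r : seq T) : coboundary (fun q => \sum_(t <- r) phi q *m free_proj_map t q *m free_inc_map t q).
  elim: r => [|t r IH].
    by apply: coboundary_ext (coboundary_zero R (free_mod k f) i) => q; rewrite big_nil.
  have c := coboundary_comp (@free_inc_map_hom t) (V t R rR _ (cocycle_comp (@free_proj_map_hom t) cphi)).
  by apply: coboundary_ext (coboundary_add c IH) => q; rewrite big_cons.
apply: coboundary_ext (H (index_enum T)) => q.
rewrite (eq_bigr (fun t => phi q *m (free_proj_map t q *m free_inc_map t q))) => [|t _]; last by rewrite mulmxA.
by rewrite -mulmx_sumr free_sum mulmx1.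
Qed.

End FreeSummands.

Lemma regmodE : regmod k n = free_mod k (fun w : P => w).
Proof.
rewrite /regmod /free_mod; congr Rep.
apply: functional_extensionality_dep => p; apply: functional_extensionality_dep => q.
by case: (le q p); apply/matrixP=> i j; rewrite !mxE.
Qed.

Lemma ext_nzE i (M N : rep) : ext_nz i M N <-> ~ ext_zero M N i.
Proof.
split=> [[R [rR /ext_nz_resE nz]] V | nV]; first by apply: nz; exact: V.
apply: NNPP => H; apply: nV => R rR; apply: NNPP => nz; apply: H.
by exists R; split=> //; apply/ext_nz_resE.
Qed.

(** The lower bound is the nonvanishing in [ext_zero_bottom], the upper bound the length of
    [simple_resolution]. *)
Lemma pdim_simple w d : pdim_le (L w) d <-> (len w <= d)%N.
Proof.
split=> [[R [rR zR]] | wd].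
  rewrite leqNgt; apply/negP=> dw.
  have /ext_zero_bottom : ext_zero (L w) (L 1%g) (len w); last by [].
  apply: (ext_zeroI (ind_rep _ (@convex1 n w)) rR) => phi _.
  apply: coboundary_ext (coboundary_zero R _ _) => x.
  by move: (phi x); rewrite (zR _ dw x) => A; rewrite [A]flatmx0.
have [R rR [_ zR]] := simple_resolution k w.
by exists R; split=> // i di; apply: zR; lia.
Qed.

(** The projective dimension is [len w], and the summand [Pr 1] already gives nonzero Ext in that
    degree; only vanishing in smaller degrees is left to ask. *)
Lemma perfect_simpleP w : perfect (simple_mod k w) <->
  forall v i, (i < len w)%N -> ext_zero (L w) (Pr v) i.
Proof.
rewrite /perfect simple_modE regmodE; split.
  move=> [g [nzg [zg [pg npg]]]] v i iw.
  have g_eq : g = len w.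
    apply/eqP; rewrite eqn_leq; apply/andP; split; last exact/pdim_simple.
    by rewrite leqNgt; apply/negP=> /npg; apply; apply/pdim_simple.
  have /ext_zero_free H : ext_zero (L w) (free_mod k (fun x : P => x)) i.
    by apply: NNPP => /ext_nzE; apply: zg; rewrite g_eq.
  exact: (H v).
move=> H; exists (len w); split.
  apply/ext_nzE => /ext_zero_free/(_ 1%g); rewrite Pr1.
  by move/ext_zero_bottom.
split=> [j jw|]; first by move/ext_nzE; apply; apply/ext_zero_free => v; exact: H.
split; first exact/pdim_simple.
by move=> d dw /pdim_simple; lia.
Qed.

Lemma parabolic_longest_ext_zero w : parabolic_longest w ->
  forall v i, (i < len w)%N -> ext_zero (L w) (Pr v) i.
Proof.
move=> [J [HJ [wJ wmax]]] v i iw; have stw := gen_stab HJ wJ.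
move: {2}(len v) (leqnn (len v)) => m; elim: m v => [|m IH] v vm.
  by rewrite (len_eq0 (_ : len v = 0%N)) ?Pr1; [apply/ext_zero_bottom; lia | lia].
have [->|/exists_descent[a Ha Hv]] := eqVneq v 1%g.
  by rewrite Pr1; apply/ext_zero_bottom; lia.
have ss := simple_sref Ha.
have [aJ|aJ] := boolP (a \in J).
  apply: (@ext_zero_descent k n (sref a)) => // [|x|x y]; last exact: lower_le.
    have : (w * sref a)%g \in generated [set sref i | i in J].
      by rewrite groupM // mem_gen // imset_f.
    by move/wmax; have := len_simple w ss; lia.
  by rewrite le_cmax // cmax_desc.
have vsv : le (v * sref a)%g v.
  by have := bruhat_simple ss (x := (v * sref a)%g); rewrite mulKsimple //; exact.
apply: (ext_zero_mid (le_ses (fun x H => le_trans H vsv) (@lower_le _))).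
  by apply: IH; lia.
(* The quotient has no support below [w]: such a [y] preserves the cuts outside [J], so it is a
   coset minimum for [sref a], and lifting puts it below [v * sref a]. *)
apply: ext_zero_support => y yw _ /=; case: (boolP (le y v)) => //= yv.
have /(cmin_mono ss) := yv; rewrite (cmin_desc Hv) cmin_asc => [-> //|].
have := len_simple y ss; have [/(stab_desc (stab_le yw stw) Ha) aJ'|] := ltnP (len (y * sref a)%g) (len y).
  by rewrite aJ' in aJ.
by lia.
Qed.

(** Strip descents [t] from [w]. If [t = s], [ext_zero_descent] applies; otherwise [Pr s] vanishes
    at the maxima of [t]-cosets, all of which lie above [t], and the shift passes to [w * t], still
    above [s] by lifting. *)
Lemma ext_zero_simple_proj w s i : simple s -> le s w -> ext_zero (L w) (Pr s) i.
Proof.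
move=> ss; move: {2}(len w) (leqnn (len w)) => m; elim: m w i => [|m IH] w i wm sw.
  by have := le_leq_len sw; rewrite len_simple1 //; lia.
have [w1|/exists_descent[a Ha Hw]] := eqVneq w 1%g.
  by have := le_leq_len sw; rewrite len_simple1 // w1 len1.
have st := simple_sref Ha; set t := sref a in st Hw.
have [ts|nts] := eqVneq t s.
  apply: (@ext_zero_descent k n s) => // [|x|x y]; last exact: lower_le.
    by rewrite -ts.
  by rewrite le_cmax // cmax_desc // -{1}(mul1g s) mulKsimple // len1 len_simple1.
have nle : ~~ le t s by apply/negP => /(simple_le st ss) /eqP; rewrite (negbTE nts).
have [|V0 VS] := @ext_zero_shift k n t st w (Pr s) Hw.
  move=> y /=; case: (boolP (le _ _)) => // ys; case/negP: nle.
  exact: le_trans (simple_le_desc st (len_cmax st y)) ys.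
case: i => [//|i]; apply/VS/IH; first by lia.
have := cmin_mono st sw; rewrite (cmin_desc Hw) cmin_asc //.
have := len_simple s st; have [/(simple_le_desc st)|] := ltnP (len (s * t)%g) (len s); last by lia.
by rewrite (negbTE nle).
Qed.

(** * Perfection forces a longest element of a parabolic subgroup *)

Section Converse.
Variable w : P.
Hypothesis Hw : forall v i, (i < len w)%N -> ext_zero (L w) (Pr v) i.
Let J : {set 'I_n} := [set i : 'I_n | (i.+1 < n)%N && le (sref i) w].

(** Perfection covers the degrees below [len w] and support those above. In degree [len w] only the
    vertex 1 counts, and [Pr x] agrees there with its submodule [Pr s] for a descent [s] of [x]. *)
Lemma ext_zero_stab_proj x i : stab J x -> x != 1%g -> ext_zero (L w) (Pr x) i.
Proof.
move=> Jx x1; have [a Ha Hx] := exists_descent x1; have ss := simple_sref Ha.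
have [iw|wi|iw] := ltngtP i (len w).
- exact: Hw.
- by apply: ext_zero_support => y _; lia.
have sx : le (sref a) x := simple_le_desc ss Hx.
have sw : le (sref a) w by have := stab_desc Jx Ha Hx; rewrite inE Ha.
apply: (ext_zero_mid (le_ses (fun y H => le_trans H sx) (@lower_le _))).
  exact: ext_zero_simple_proj.
apply: ext_zero_support => y _ yi /=; have /len_eq0 -> : len y = 0%N by lia.
by rewrite (le1g (sref a)) andbF.
Qed.

Section CosetSets.
Variable s : P.
Hypothesis ss : simple s.
Local Notation c := (cmax s).

Lemma below_lower v : c v = v -> forall x y, le y x ->
  le x v && (c x != v) -> le y v && (c y != v).
Proof.
move=> cv x y yx /andP[xv xn]; rewrite (le_trans yx xv) /=.
apply: contra xn => /eqP e; apply/eqP/le_anti; first by rewrite le_cmax.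
by rewrite -e; exact: cmax_mono.
Qed.

(** The fibre over [v] is the quotient of [Pr v] by the part of the interval outside the coset of
    [v]. *)
Lemma ext_zero_fiber v : c v = v -> stab J v ->
  (forall i, ext_zero (L w) (ind k (fun x => le x v && (c x != v))) i) ->
  forall i, ext_zero (L w) (ind k (fun x => c x == v)) i.
Proof.
move=> cv Jv VT i.
have v1 : v != 1%g.
  by apply/eqP=> e; have := len_cmax ss v; rewrite cv e len1.
have H := le_ses (fun x (h : le x v && (c x != v)) => proj1 (andP h)) (below_lower cv).
have := ext_zero_quot H (ext_zero_stab_proj (i := i) Jv v1) (VT i.+1).
rewrite (@ind_ext (fun q => le q v && ~~ (le q v && (c q != v))) (fun x => c x == v)) // => x.
case: (eqVneq (c x) v) => [e|_] /=; last by rewrite andbT andbN.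
by rewrite andbF andbT -e cmax_ge.
Qed.

Lemma ext_zero_lower (S : P -> bool) i : (forall x y, le y x -> S x -> S y) ->
  (forall x, S (c x) = S x) -> (forall x, S x -> stab J x) ->
  ext_zero (L w) (ind k S) i.
Proof.
move: {2}#|[set x | S x]| (leqnn #|[set x | S x]|) => m.
elim: m S i => [|m IH] S i Sm Sl Sc SJ.
  apply: ext_zero_support => y _ _ /=; case: (boolP (S y)) => // Sy.
  by move: Sm; rewrite leqn0 cards_eq0 => /eqP/setP/(_ y); rewrite !inE Sy.
have [/existsP[v0 Sv0]|S0] := boolP [exists x, S x]; last first.
  apply: ext_zero_support => y _ _ /=; case: (boolP (S y)) => // Sy.
  by case/existsP: S0; exists y.
(* Remove the coset of a longest element [v]: what remains of [S] is a smaller lower union of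
   cosets, and so is the rest of the interval below [v], which settles the removed fibre. *)
have [v Sv vmax] := arg_maxnP (fun x => len x) Sv0.
have closed x : S x -> le v x -> x = v.
  by move=> Sx vx; case: (le_len vx) => // h; have := vmax x Sx; rewrite /=; lia.
have cv : c v = v by apply: closed; rewrite ?Sc ?cmax_ge.
have card_lt (S' : P -> bool) : (forall x, S' x -> S x && (c x != v)) ->
    (#|[set x | S' x]| <= m)%N.
  move=> H; rewrite -ltnS; apply: leq_trans Sm; apply/proper_card/properP; split.
    by apply/subsetP=> x; rewrite !inE => /H/andP[].
  by exists v; rewrite !inE //; apply/negP=> /H; rewrite cv eqxx andbF.
have VT j : ext_zero (L w) (ind k (fun x => le x v && (c x != v))) j.
  apply: IH.
  - by apply: card_lt => x /andP[xv ->]; rewrite (Sl v).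
  - exact: below_lower.
  - by move=> x; rewrite le_cmax // cmax_idem.
  - by move=> x /andP[xv _]; apply: SJ; exact: Sl xv Sv.
have S'l x y : le y x -> S x && (c x != v) -> S y && (c y != v).
  move=> yx /andP[Sx xn]; rewrite (Sl x) //=; apply: contra xn => /eqP e.
  by apply/eqP/closed; rewrite ?Sc // -e; exact: cmax_mono.
have VS' : ext_zero (L w) (ind k (fun x => S x && (c x != v))) i.
  apply: IH => //; first exact: card_lt.
    by move=> x; rewrite Sc cmax_idem.
  by move=> x /andP[/SJ].
have VE := ext_zero_fiber (i := i) cv (SJ v Sv) VT.
have H : ses (@ind_map k n (fun x => S x && (c x != v)) S) (@ind_map k n S (fun x => c x == v)).
  apply: ind_ses; first exact: convex_lower.
  - move=> x; case: (eqVneq (c x) v) => [e|_] /=; last by rewrite andbT orbF.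
    by rewrite andbF -Sc e.
  - by move=> x; case: (c x == v); rewrite /= ?andbF.
  - by move=> x y yx h _; exact: S'l h.
exact: (ext_zero_mid H VS' VE).
Qed.

Lemma ext_zero_coset v i : c v = v -> stab J v ->
  ext_zero (L w) (ind k (fun x => c x == v)) i.
Proof.
move=> cv Jv; apply: ext_zero_fiber => // j; apply: ext_zero_lower.
- exact: below_lower.
- by move=> x; rewrite le_cmax // cmax_idem.
- by move=> x /andP[xv _]; exact: stab_le xv Jv.
Qed.

End CosetSets.

(** For a descent [s] of [v], Ext into the module on the coset of [v] vanishes, so vanishing passes
    from its quotient at [v] to its submodule at [v * s]. *)
Lemma ext_zero_descend v : stab J v -> (forall i, ext_zero (L w) (L v) i) ->
  forall i, ext_zero (L w) (L 1%g) i.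
Proof.
move: {2}(len v) (leqnn (len v)) => m; elim: m v => [|m IH] v vm Jv V.
  by rewrite -(len_eq0 (_ : len v = 0%N)) //; lia.
have [<- //|/exists_descent[a Ha Hv]] := eqVneq v 1%g.
have ss := simple_sref Ha; have H := coset_ses k ss Hv.
have VE i := ext_zero_coset (i := i) ss (cmax_desc Hv) Jv.
apply: (IH (v * sref a)%g); first by lia.
  by apply: stab_le Jv; have := bruhat_simple ss (x := (v * sref a)%g); rewrite mulKsimple //; exact.
case=> [|i]; first exact: (ext_zero_sub0 H (VE 0%N)).
exact: (ext_zero_sub H (V i) (VE i.+1)).
Qed.

(** If [v] is not below [w], support kills every Ext into the simple module at [v]; descending to
    the identity contradicts [ext_zero_bottom]. *)
Lemma stab_le_top v : stab J v -> le v w.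
Proof.
move=> Jv; apply: contraT => vw.
have V i : ext_zero (L w) (L v) i.
  apply: ext_zero_support => y yw _ /=; case: eqP => // e.
  by rewrite -e yw in vw.
by have /ext_zero_bottom := ext_zero_descend (i := len w) Jv V.
Qed.

Lemma ext_zero_parabolic_longest : parabolic_longest w.
Proof.
exists J; split; first by move=> i; rewrite inE => /andP[].
split; first exact: gen_simple_le.
(* Maximality holds in the stronger Bruhat sense: the whole subgroup lies below [w]. *)
move=> v vJ; apply/le_leq_len/stab_le_top/gen_stab => // i.
by rewrite inE => /andP[].
Qed.

End Converse.
End Perfection.

Theorem theorem7p3 (k : closedFieldType) (n : nat) (w : {perm 'I_n}) :
  [pchar k]%R =i pred0 ->
  (perfect (simple_mod k w) <-> parabolic_longest w).
Proof.
move=> _; rewrite perfect_simpleP; split; first exact: ext_zero_parabolic_longest.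
exact: parabolic_longest_ext_zero.
Qed.
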